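(* Let $\mathcal{V}$ be a variety of groups, let $A$ be a set, and let $H$ be a finitely generated subgroup of the free group $F_A$ on $A$. Let $\mathcal{V}^f$ be the pseudovariety of finite groups belonging to $\mathcal{V}$, let $\mathbf{G}$ be the pseudovariety of all finite groups, and let $\pi_{\mathcal{V}}:F_A\to F_A/F_A^{\mathcal{V}}$ be the canonical homomorphism. Then: (i) $\mathrm{Cl}_{\mathcal{V}^f}^{F_A}(H)=\pi_{\mathcal{V}}^{-1}\bigl(\mathrm{Cl}_{\mathbf{G}}^{F_A/F_A^{\mathcal{V}}}(\pi_{\mathcal{V}}(H))\bigr)\geq HF_A^{\mathcal{V}}$; (ii) if $A$ is infinite, then $\mathrm{Cl}_{\mathcal{V}^f}^{F_A}(H)$ is finitely generated if and only if $\mathcal{V}$ is the variety of all groups; (iii) if $A$ is finite, then $\mathrm{Cl}_{\mathcal{V}^f}^{F_A}(H)$ is finitely generated if and only if $\mathcal{V}$ is the variety of all groups or $\mathrm{Cl}_{\mathcal{V}^f}^{F_A}(H)$ has finite index in $F_A$; (iv) if $\mathcal{V}^f$ is a decidable pseudovariety, then it is decidable whether or not $H$ is $\mathcal{V}^f$-closed.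
   Context: A variety of groups is a class of groups closed under taking subgroups, homomorphic images and arbitrary direct products; equivalently (Birkhoff), the class of all groups satisfying some set $I\subseteq F_X$ of group identities, where $X$ is a countable alphabet and a group $G$ satisfies $u\in F_X$ if $\varphi(u)=1$ for every homomorphism $\varphi:F_X\to G$. If $\mathcal{V}$ is defined by the set of identities $I$, then $F_A^{\mathcal{V}}$ is the normal closure in $F_A$ of $\{\varphi(u)\mid u\in I,\ \varphi:F_X\to F_A \text{ a homomorphism}\}$; the quotient $F_A/F_A^{\mathcal{V}}$ is the free object of $\mathcal{V}$ on $A$. A pseudovariety (of finite groups) is a class of finite groups closed under taking subgroups, homomorphic images and finitary direct products; it is decidable if membership of a given finite group in it is decidable. The finite trace $\mathcal{V}^f$ is the class of all finite groups in $\mathcal{V}$. For a pseudovariety $\mathbf{V}$, the pro-$\mathbf{V}$ topology on a group $G$ is the coarsest topology making all homomorphisms from $G$ to elements of $\mathbf{V}$ (with the discrete topology) continuous; equivalently, the normal subgroups $K$ of $G$ with $G/K\in\mathbf{V}$ form a basis of neighbourhoods of the identity. $\mathrm{Cl}_{\mathbf{V}}^G(S)$ denotes the closure of $S\subseteq G$ in this topology. A subgroup is $\mathbf{V}$-closed if it is closed in the pro-$\mathbf{V}$ topology. Decidability convention: the basis $A$ of the free group is fixed, and the input is a finite generating set of $H$, given as reduced words over $A\cup A^{-1}$.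
   Formalization: In (iii) the case where A has exactly one element and H is trivial is excluded, since the claim fails there: for V the abelian groups and F_A = Z, the closure of 1 is trivial, hence finitely generated, but has infinite index and V is not the variety of all groups. *)

(* Defs.v *)
From HB Require Import structures.
From mathcomp Require Import all_boot.
From mathcomp Require Import boolp classical_sets functions cardinality.
From mathcomp Require Import topology_structure.

Set Implicit Arguments.
Unset Strict Implicit.
Unset Printing Implicit Defensive.

Local Open Scope classical_set_scope.
Local Open Scope group_scope.

(* Possibly infinite groups are the groupTypes of MathComp's monoid.v; the    *)
(* homomorphisms are its {multiplicative G -> K}, which preserve 1 and ^-1    *)
(* because G and K are groups.                                                *)

Section Subgroups.
Variable G : groupType.
Implicit Types (S : set G).

Definition is_subgroup S : Prop :=
  [/\ S 1, forall x y, S x -> S y -> S (x * y) & forall x, S x -> S x^-1].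

Definition is_normal S : Prop :=
  is_subgroup S /\ forall x g, S x -> S (x ^ g).

Definition generated S : set G := smallest is_subgroup S.

Definition finitely_generated S : Prop :=
  exists s : seq G, S = generated [set` s].

Definition normal_closure S : set G := smallest is_normal S.

Definition set_prod (S T : set G) : set G :=
  [set z | exists x y, [/\ S x, T y & z = x * y]].

Definition finite_index S : Prop :=
  finite_set (range (fun x : G => [set x * s | s in S])).

Lemma normal_closure_normal S : is_normal (normal_closure S).
Proof.
split; first split.
- by move=> N [[[N1 _ _] _] _].
- by move=> x y Sx Sy N NS; case: (NS) => -[[_ NM _] _] _; apply: NM;
    [exact: Sx | exact: Sy].
- by move=> x Sx N NS; case: (NS) => -[[_ _ NV] _] _; apply: NV; exact: Sx.
by move=> x g Sx N NS; case: (NS) => -[_ NJ] _; apply: NJ; exact: Sx.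
Qed.

End Subgroups.

Record normal_subgroup (G : groupType) := NormalSubgroup {
  normal_set :> set G;
  normalP : is_normal normal_set }.

(* The quotient group G / N, with canonical homomorphism quotient_map N.      *)
Section Quotient.
Variables (G : groupType) (N : normal_subgroup G).

Definition coset_rel : rel G := fun x y => `[< normal_set N (x^-1 * y) >].

Let N1 : normal_set N 1. Proof. by case: (normalP N) => -[]. Qed.
Let NM x y : normal_set N x -> normal_set N y -> normal_set N (x * y).
Proof. by case: (normalP N) => -[_ + _] _; apply. Qed.
Let NV x : normal_set N x -> normal_set N x^-1.
Proof. by case: (normalP N) => -[_ _ +] _; apply. Qed.
Let NJ x g : normal_set N x -> normal_set N (x ^ g).
Proof. by case: (normalP N) => _; apply. Qed.

Fact coset_rel_refl : reflexive coset_rel.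
Proof. by move=> x; apply/asboolP; rewrite mulVg. Qed.

Fact coset_rel_sym : symmetric coset_rel.
Proof.
by move=> x y; apply/asboolP/asboolP => /NV; rewrite invgM invgK.
Qed.

Fact coset_rel_trans : transitive coset_rel.
Proof.
move=> y x z /asboolP xy /asboolP yz; apply/asboolP.
by have := NM xy yz; rewrite -mulgA mulVKg.
Qed.

Canonical coset_equiv :=
  EquivRel coset_rel coset_rel_refl coset_rel_sym coset_rel_trans.

Definition quotient_group := {eq_quot coset_equiv}%qT.
HB.instance Definition _ := Choice.on quotient_group.

Definition quotient_map (x : G) : quotient_group := (\pi x)%qT.

Lemma quotient_mapP x y :
  quotient_map x = quotient_map y <-> normal_set N (x^-1 * y).
Proof.
by split=> [/eqmodP/asboolP//|Nxy]; apply/eqmodP/asboolP.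
Qed.

Lemma quotient_map_repr q : quotient_map (repr q) = q.
Proof. exact: reprK. Qed.

Definition quot_one : quotient_group := quotient_map 1.
Definition quot_mul (p q : quotient_group) : quotient_group :=
  quotient_map (repr p * repr q).
Definition quot_inv (q : quotient_group) : quotient_group :=
  quotient_map (repr q)^-1.

Lemma quot_mulE x y :
  quot_mul (quotient_map x) (quotient_map y) = quotient_map (x * y).
Proof.
rewrite /quot_mul; set x' := repr _; set y' := repr _.
have /quotient_mapP xx' : quotient_map x' = quotient_map x.
  exact: quotient_map_repr.
have /quotient_mapP yy' : quotient_map y' = quotient_map y.
  exact: quotient_map_repr.
apply/quotient_mapP.
have -> : (x' * y')^-1 * (x * y) = (x'^-1 * x) ^ y' * (y'^-1 * y).
  by rewrite /conjg invgM !mulgA mulgK.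
by apply: NM => //; apply: NJ.
Qed.

Lemma quot_invE x : quot_inv (quotient_map x) = quotient_map x^-1.
Proof.
rewrite /quot_inv; set x' := repr _.
have /quotient_mapP xx' : quotient_map x' = quotient_map x.
  exact: quotient_map_repr.
apply/quotient_mapP; rewrite invgK.
have -> : x' * x^-1 = ((x'^-1 * x) ^ x'^-1)^-1.
  by rewrite /conjg invgK -mulgA mulVKg invgM invgK.
by apply/NV/NJ.
Qed.

Fact quot_mulA : associative quot_mul.
Proof.
move=> p q r; rewrite -(quotient_map_repr p) -(quotient_map_repr q).
by rewrite -(quotient_map_repr r) !quot_mulE mulgA.
Qed.

Fact quot_mul1 : left_id quot_one quot_mul.
Proof. by move=> p; rewrite -(quotient_map_repr p) quot_mulE mul1g. Qed.

Fact quot_1mul : right_id quot_one quot_mul.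
Proof. by move=> p; rewrite -(quotient_map_repr p) quot_mulE mulg1. Qed.

Fact quot_mulV : left_inverse quot_one quot_inv quot_mul.
Proof.
by move=> p; rewrite -(quotient_map_repr p) quot_invE quot_mulE mulVg.
Qed.

Fact quot_Vmul : right_inverse quot_one quot_inv quot_mul.
Proof.
by move=> p; rewrite -(quotient_map_repr p) quot_invE quot_mulE mulgV.
Qed.

HB.instance Definition _ := isGroup.Build quotient_group
  quot_mulA quot_mul1 quot_1mul quot_mulV quot_Vmul.

Fact quotient_mapM : {morph quotient_map : x y / x * y}.
Proof. by move=> x y; rewrite -quot_mulE. Qed.

HB.instance Definition _ :=
  isMultiplicative.Build G quotient_group quotient_map quotient_mapM.

End Quotient.

Section DirectProduct.
Variables (I : Type) (G : I -> groupType).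

Definition group_prod : Type := forall i, G i.
HB.instance Definition _ := Choice.on group_prod.

Definition prod_one : group_prod := fun=> 1.
Definition prod_mul (x y : group_prod) : group_prod := fun i => x i * y i.
Definition prod_inv (x : group_prod) : group_prod := fun i => (x i)^-1.

Fact prod_mulA : associative prod_mul.
Proof. by move=> x y z; apply: functional_extensionality_dep => i;
  exact: mulgA. Qed.
Fact prod_mul1 : left_id prod_one prod_mul.
Proof. by move=> x; apply: functional_extensionality_dep => i;
  exact: mul1g. Qed.
Fact prod_1mul : right_id prod_one prod_mul.
Proof. by move=> x; apply: functional_extensionality_dep => i;
  exact: mulg1. Qed.
Fact prod_mulV : left_inverse prod_one prod_inv prod_mul.
Proof. by move=> x; apply: functional_extensionality_dep => i;
  exact: mulVg. Qed.
Fact prod_Vmul : right_inverse prod_one prod_inv prod_mul.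
Proof. by move=> x; apply: functional_extensionality_dep => i;
  exact: mulgV. Qed.

HB.instance Definition _ := isGroup.Build group_prod
  prod_mulA prod_mul1 prod_1mul prod_mulV prod_Vmul.

End DirectProduct.

(* The free group on A, carried by the reduced words over A and its inverses: *)
(* the letter (a, false) is a, the letter (a, true) is a^-1.                  *)
Section FreeGroup.
Variable A : choiceType.
Notation letter := (A * bool)%type.
Implicit Types (l m : letter) (u v w : seq letter).

Definition letter_inv l : letter := (l.1, ~~ l.2).

Definition reduced w : bool := sorted (fun l m => m != letter_inv l) w.

Record free_group := FreeGroup { word :> seq letter; _ : reduced word }.
HB.instance Definition _ := [isSub for word].
HB.instance Definition _ := [Choice of free_group by <:].

Definition lmul l w : seq letter :=
  if w is m :: w' then if m == letter_inv l then w' else l :: w else [:: l].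

Lemma letter_invK : involutive letter_inv.
Proof. by case=> a b; rewrite /letter_inv /= negbK. Qed.

Lemma reduced_lmul l w : reduced w -> reduced (lmul l w).
Proof.
case: w => [//|m w] /= rw; case: ifP => [_|/negbT ml] /=; last by rewrite ml.
exact: path_sorted rw.
Qed.

Lemma lmulK l w : reduced w -> lmul (letter_inv l) (lmul l w) = w.
Proof.
case: w => [|m w] /=; first by rewrite letter_invK eqxx.
case: eqP => [-> | _] /=; last by rewrite letter_invK eqxx.
by case: w => [//|m' w] /= /andP[/negbTE ->].
Qed.

Lemma reduced_foldr u v : reduced v -> reduced (foldr lmul v u).
Proof. by move=> rv; elim: u => //= l u; apply: reduced_lmul. Qed.

Lemma foldr_lmul1 u : reduced u -> foldr lmul [::] u = u.
Proof.
elim: u => //= l u IHu rlu; rewrite (IHu (path_sorted rlu)).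
by case: u rlu {IHu} => //= m u /andP[/negbTE ->].
Qed.

Lemma foldr_lmulA u v w : reduced v -> reduced w ->
  foldr lmul (foldr lmul w v) u = foldr lmul w (foldr lmul v u).
Proof.
move=> rv rw; elim: u => //= l u ->.
have := reduced_foldr u rv; case: (foldr lmul v u) => [//|m t] /= rt.
case: eqP => [-> | _] //=.
by rewrite -{1}[l]letter_invK lmulK // reduced_foldr.
Qed.

Lemma reduced_inv u : reduced u -> reduced (rev (map letter_inv u)).
Proof.
rewrite /reduced rev_sorted sorted_map; apply: sub_sorted => l m /=.
by rewrite letter_invK eq_sym.
Qed.

Lemma foldr_lmulV u : foldr lmul u (rev (map letter_inv u)) = [::].
Proof.
by elim: u => //= l u IHu; rewrite rev_cons foldr_rcons /= letter_invK eqxx.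
Qed.

Definition free_one : free_group := @FreeGroup [::] isT.
Definition free_mul (x y : free_group) : free_group :=
  FreeGroup (reduced_foldr x (valP y)).
Definition free_inv (x : free_group) : free_group :=
  FreeGroup (reduced_inv (valP x)).

Fact free_mulA : associative free_mul.
Proof.
move=> x y z; apply/val_inj => /=.
by apply: foldr_lmulA; [exact: (valP y) | exact: (valP z)].
Qed.
Fact free_mul1 : left_id free_one free_mul.
Proof. by move=> x; apply/val_inj. Qed.
Fact free_1mul : right_id free_one free_mul.
Proof. by move=> x; apply/val_inj; apply: foldr_lmul1 (valP x). Qed.
Fact free_mulV : left_inverse free_one free_inv free_mul.
Proof. by move=> x; apply/val_inj; apply: foldr_lmulV. Qed.
Fact free_Vmul : right_inverse free_one free_inv free_mul.
Proof.
move=> x; have xK : free_inv (free_inv x) = x.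
  by apply/val_inj => /=; rewrite map_rev revK (mapK letter_invK).
by rewrite -{1}xK free_mulV.
Qed.

HB.instance Definition _ := isGroup.Build free_group
  free_mulA free_mul1 free_1mul free_mulV free_Vmul.

Definition free_gen (a : A) : free_group := @FreeGroup [:: (a, false)] isT.

Section UniversalProperty.
Variables (G : groupType) (h : A -> G).

Definition letter_val l : G := if l.2 then (h l.1)^-1 else h l.1.

Definition free_ext (x : free_group) : G :=
  foldr (fun l g => letter_val l * g) 1 (word x).

Fact free_extM : {morph free_ext : x y / x * y}.
Proof.
have valV l : letter_val (letter_inv l) = (letter_val l)^-1.
  by case: l => a [] //=; rewrite /letter_val /= invgK.
move=> [u ru] [v rv]; rewrite /free_ext /= {ru rv}.
elim: u => [|l u IHu] /=; first by rewrite mul1g.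
rewrite -mulgA -IHu; case: (foldr lmul v u) => //= m w.
by case: eqP => [-> | _] //=; rewrite valV mulVKg.
Qed.

HB.instance Definition _ :=
  isMultiplicative.Build free_group G free_ext free_extM.

Lemma free_ext_gen a : free_ext (free_gen a) = h a.
Proof. exact: mulg1. Qed.

Lemma free_ext_unique (f : {multiplicative free_group -> G}) :
  (forall a, f (free_gen a) = h a) -> f =1 free_ext.
Proof.
move=> fh; have f1 : f 1 = 1 by apply: (mulgI (f 1)); rewrite -gmulfM !mulg1.
have fV x : f x^-1 = (f x)^-1.
  by apply: (mulgI (f x)); rewrite -gmulfM !mulgV.
move=> [w rw]; elim: w rw => [|[a b] w IHw] rw.
  by rewrite -[RHS]f1; congr (f _); apply/val_inj.
have rw' : reduced w by apply: path_sorted rw.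
have -> : FreeGroup rw =
    (if b then (free_gen a)^-1 else free_gen a) * FreeGroup rw'.
  apply/val_inj; case: b rw => rw /=; rewrite -[LHS](foldr_lmul1 rw) /=;
  by rewrite (foldr_lmul1 rw').
rewrite gmulfM free_extM (IHw rw'); congr (_ * _).
by case: b {rw}; rewrite ?fV fh /free_ext /= /letter_val /= mulg1.
Qed.

End UniversalProperty.

End FreeGroup.

Definition group_class := groupType -> Prop.

Definition satisfies (G : groupType) (u : free_group nat) : Prop :=
  forall phi : {multiplicative free_group nat -> G}, phi u = 1.

(* Closure under embeddings and surjections includes closure under            *)
(* isomorphism, which a class of structures does not have by itself.          *)
Record is_variety (V : group_class) : Prop := IsVariety {
  variety_sub : forall (G K : groupType) (f : {multiplicative K -> G}),
    injective f -> V G -> V K;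
  variety_image : forall (G K : groupType) (f : {multiplicative G -> K}),
    (forall y, exists x, f x = y) -> V G -> V K;
  variety_prod : forall (I : Type) (G : I -> groupType),
    (forall i, V (G i)) -> V (group_prod G) }.

Definition defined_by (V : group_class) (I : set (free_group nat)) : Prop :=
  forall G, V G <-> forall u, I u -> satisfies G u.

Definition identities (V : group_class) : set (free_group nat) :=
  [set u | forall G, V G -> satisfies G u].

Definition substitution_instances (I : set (free_group nat)) (A : choiceType) :
    set (free_group A) :=
  [set w | exists u (phi : {multiplicative free_group nat -> free_group A}),
     I u /\ w = phi u].

(* F_A^V, obtained from the largest set of identities that defines V; by      *)
(* verbal_defined_by every other set that defines V gives the same subgroup.  *)
Definition verbal (V : group_class) (A : choiceType) :
    normal_subgroup (free_group A) :=
  NormalSubgroup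
    (normal_closure_normal (@substitution_instances (identities V) A)).

Lemma verbal_defined_by (V : group_class) (I : set (free_group nat))
    (A : choiceType) : defined_by V I ->
  verbal V A = normal_closure (@substitution_instances I A) :> set _.
Proof.
move=> VI; set S := @substitution_instances I A .
have quot1 N (w : free_group A) :
    quotient_map N w = 1 <-> normal_set N w.
  split=> [w1|Nw]; last by apply/esym/quotient_mapP; rewrite invg1 mul1g.
  by rewrite -[w]mul1g -invg1; apply/quotient_mapP.
pose N := NormalSubgroup (normal_closure_normal S).
have VQ : V (quotient_group N).
  apply/VI => u Iu psi.
  pose phi := free_ext (fun n => repr (psi (free_gen n))).
  have -> : psi u = quotient_map N (phi u).
    rewrite (free_ext_unique (fun n => erefl (psi (free_gen n)))).
    pose g : {multiplicative _ -> _} := quotient_map N \o phi.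
    rewrite -[RHS]/(g u); apply/esym/free_ext_unique => n /=.
    by rewrite free_ext_gen quotient_map_repr.
  apply/quot1 => M [_]; apply; exists u, phi; split=> //.
rewrite eqEsubset; split=> w.
  move=> Vw; apply: (Vw N); split; first exact: normal_closure_normal.
  move=> _ [u [phi [Vu ->]]]; apply/quot1.
  exact: (Vu _ VQ (quotient_map N \o phi)).
move=> Sw M [nM VM]; apply: Sw; split=> // _ [u [phi [Iu ->]]]; apply: VM.
by exists u, phi; split=> // G VG; apply: (VI G).1.
Qed.

Definition finite_trace (V : group_class) : group_class :=
  fun G => V G /\ finite_set [set: G].

Definition finite_groups : group_class := fun G => finite_set [set: G].

(* G with its pro-V topology: the subbase of all preimages f @^-1` B, with f  *)
(* a homomorphism to a group K in V and B any subset of the discrete group K. *)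
Definition pro (V : group_class) (G : groupType) : Type := G.

Section ProTopology.
Variables (V : group_class) (G : groupType).

Definition pro_subbase : set (set G) :=
  [set U | exists (K : groupType) (f : {multiplicative G -> K}) (B : set K),
     V K /\ U = f @^-1` B].

HB.instance Definition _ := Choice.on (pro V G).
HB.instance Definition _ :=
  isSubBaseTopological.Build (pro V G) pro_subbase id.

Definition pro_closure (S : set G) : set G := closure (S : set (pro V G)).

Definition pro_closed (S : set G) : Prop := closed (S : set (pro V G)).

End ProTopology.

(* The total recursive functions of Kleene: the least class that contains the *)
(* initial functions and is closed under composition, primitive recursion and *)
(* minimization of regular functions.                                         *)
Inductive total_recursive : forall k, (k.-tuple nat -> nat) -> Prop :=
| Rec_zero k : total_recursive (fun _ : k.-tuple nat => 0)
| Rec_succ : total_recursive (fun x : 1.-tuple nat => (thead x).+1)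
| Rec_proj k (i : 'I_k) : total_recursive (fun x : k.-tuple nat => tnth x i)
| Rec_comp k m (g : m.-tuple nat -> nat) (h : 'I_m -> k.-tuple nat -> nat) :
    total_recursive g -> (forall i, total_recursive (h i)) ->
    total_recursive (fun x : k.-tuple nat => g [tuple h i x | i < m])
| Rec_prim k (f : k.-tuple nat -> nat) (g : k.+2.-tuple nat -> nat)
    (h : k.+1.-tuple nat -> nat) :
    total_recursive f -> total_recursive g ->
    (forall x : k.-tuple nat, h [tuple of 0 :: x] = f x) ->
    (forall n (x : k.-tuple nat), h [tuple of n.+1 :: x] =
                 g [tuple of n :: h [tuple of n :: x] :: x]) ->
    total_recursive h
| Rec_min k (f : k.+1.-tuple nat -> nat) (h : k.-tuple nat -> nat) :
    total_recursive f ->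
    (forall x : k.-tuple nat, f [tuple of h x :: x] = 0) ->
    (forall (x : k.-tuple nat) n, (n < h x)%N -> f [tuple of n :: x] <> 0) ->
    total_recursive h.

(* The problem P on the instances in D, presented by their codes, has a       *)
(* recursive decision procedure (answer 1 for yes, any other value for no).   *)
Definition recursively_decidable (T : Type) (D : set T) (code : T -> nat)
    (P : T -> Prop) : Prop :=
  exists f : 1.-tuple nat -> nat, total_recursive f /\
    forall x, D x -> (f [tuple code x] = 1%N <-> P x).

Definition code_seq2 (s : seq (seq nat)) : nat :=
  CodeSeq.code (map CodeSeq.code s).

(* A finite group is given by a multiplication table on {0, ..., n-1}.        *)
Record table := Table {
  table_size : nat;
  table_op : 'I_table_size -> 'I_table_size -> 'I_table_size }.

Definition table_of (t : table) (G : groupType) : Prop :=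
  exists e : 'I_(table_size t) -> G,
    bijective e /\ forall i j, e (table_op i j) = e i * e j.

Definition code_table (t : table) : nat :=
  code_seq2 [seq [seq val (table_op i j) | j : 'I_(table_size t)]
               | i : 'I_(table_size t)].

Definition decidable_class (W : group_class) : Prop :=
  recursively_decidable [set t | exists G, table_of t G] code_table
    (fun t => exists2 G, table_of t G & W G).

(* A finite sequence of reduced words over the letters in B, where e numbers  *)
(* the letters.                                                               *)
Definition words_over (A : choiceType) (B : set A) : set (seq (free_group A)) :=
  [set ws | forall w, w \in ws -> forall l, l \in word w -> B l.1].

Definition code_letter (A : choiceType) (e : A -> nat) (l : A * bool) : nat :=
  (e l.1).*2 + l.2.

Definition code_words (A : choiceType) (e : A -> nat)
    (ws : seq (free_group A)) : nat :=
  code_seq2 [seq map (code_letter e) (word w) | w <- ws].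

(* The basis A is fixed, the input is a list of generators. An algorithm can  *)
(* read countably many letters only, hence the numbered alphabet B; if A is   *)
(* countable, B can be all of A.                                              *)
Definition decidable_closedness (W : group_class) (A : choiceType) : Prop :=
  forall (B : set A) (e : A -> nat), set_inj B e ->
  recursively_decidable (words_over B) (code_words e)
    (fun ws => pro_closed W (generated [set` ws])).

(* Main.v *)
Require Import Defs.
From mathcomp Require Import all_boot.
From mathcomp Require Import boolp classical_sets functions cardinality.
From mathcomp Require Import topology_structure.
From HB Require Import structures.
From mathcomp Require Import perm finmap zify.

Set Implicit Arguments.
Unset Strict Implicit.
Unset Printing Implicit Defensive.

Local Open Scope classical_set_scope.
Local Open Scope group_scope.

(** Write [F] for the free group on [A], [N] for its verbal subgroup and [Cl] for
    the closure of [H] in the pro-topology of the finite groups of the variety.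

    A point is in the closure of [H] iff no homomorphism to a finite group of the
    variety separates it from [H] ([pro_closureP]). By Birkhoff's argument the
    quotient [F / N] belongs to the variety ([variety_relatively_free]), so the
    finite groups of the variety that are images of [F] are the finite images of
    [F / N]. This gives (i), and shows that [N] is contained in [Cl].

    If [N] is trivial then all finite images of [F] are allowed, and a finitely
    generated [H] is closed by Marshall Hall's theorem ([hall_separation]): the
    finite graph of cosets of [H] spanned by the generators of [H] and by a given
    element outside of [H] carries a partial action of [F], which extends to an
    action on a finite set.

    If [N] is not trivial and [Cl] is finitely generated, then [Cl] is a finitely
    generated subgroup containing a nontrivial normal subgroup. Such a subgroup
    involves all letters ([normal_all_letters]), which excludes an infinite [A].
    It also has finite index ([full_prefix_reps]): each [g] in [F] is a prefix of
    an element of [N] of the form [g c w c^-1 g^-1], and the cosets of the prefixes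
    of its elements are among the finitely many cosets of the prefixes of its
    generators, which are the vertices of its Stallings graph. A variety with a
    nontrivial law has a nontrivial [N] as soon as there are two letters, since a
    free group of countable rank embeds into [F] ([verbal_nontrivial]); if there
    is a single letter, any nontrivial subgroup can take the part of [N]. With
    Schreier's lemma this proves (ii) and (iii).

    For (iv), suppose that [N] is not trivial and that [A] is finite, the other
    cases being settled by a constant answer. A closed [H] has finite index, and
    its index is at most the number of vertices of the Stallings graph, which is
    less than a number [n] computed from the input. Consider the actions of [F] on
    [n] points in which the generators of [H] fix the point 0. Then [H] is closed
    iff for each of these actions the orbit of 0 is not everything and the action
    on this orbit factors through a finite group of the variety. Indeed, a
    subgroup of index at least [n] has such an action that is transitive, again by
    completing a partial action on cosets; and the action on all cosets of [H],
    if they are fewer than [n], is covered by a finite group of the variety iff [H]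
    is closed. There are finitely many actions, and the order of the finite group
    can be bounded, so this is a bounded search which uses the decision procedure
    for the finite trace of the variety on multiplication tables. It is shown to
    be recursive by closure properties of the recursive functions
    ([recursive_closedness_test]), with finite functions coded by numerals. *)

(** * Homomorphisms, quotients and subgroups *)

Definition hom_of (G K : groupType) (f : G -> K) (fM : {morph f : x y / x * y}) :
    {multiplicative G -> K} :=
  HB.pack_for {multiplicative G -> K} f (isMultiplicative.Build _ _ f fM).

Section GroupBasics.
Variables (G K : groupType) (f : {multiplicative G -> K}).

Lemma hom1 : f 1 = 1.
Proof. by apply: (mulgI (f 1)); rewrite -gmulfM !mulg1. Qed.

Lemma homV x : f x^-1 = (f x)^-1.
Proof. by apply: (mulgI (f x)); rewrite -gmulfM !mulgV hom1. Qed.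

Lemma hom_eq x y : f x = f y <-> f (x^-1 * y) = 1.
Proof.
rewrite gmulfM homV; split=> [->|xy]; first by rewrite mulVg.
by apply: (mulgI (f x)^-1); rewrite mulVg.
Qed.

Lemma kernel_normal : is_normal [set x | f x = 1].
Proof.
split; first split=> [|x y /= fx fy|x /= fx].
- exact: hom1.
- by rewrite gmulfM fx fy mulg1.
- by rewrite homV fx invg1.
by move=> x g /= fx; rewrite /conjg !gmulfM homV fx mul1g mulVg.
Qed.

Definition kernel := NormalSubgroup kernel_normal.

Lemma quotient_kernelP x y :
  quotient_map kernel x = quotient_map kernel y <-> f x = f y.
Proof. by rewrite quotient_mapP hom_eq. Qed.

End GroupBasics.

Lemma quotient_map_eq1 (G : groupType) (N : normal_subgroup G) x :
  quotient_map N x = 1 <-> normal_set N x.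
Proof.
rewrite -(hom1 (quotient_map N)); split=> [/esym/quotient_mapP|Nx].
  by rewrite invg1 mul1g.
by apply/esym/quotient_mapP; rewrite invg1 mul1g.
Qed.

Lemma factor_quotient (G K : groupType) (N : normal_subgroup G)
    (f : {multiplicative G -> K}) : (forall x, normal_set N x -> f x = 1) ->
  exists g : {multiplicative quotient_group N -> K},
    forall x, g (quotient_map N x) = f x.
Proof.
move=> fN; pose g (q : quotient_group N) := f (repr q).
have gE x : g (quotient_map N x) = f x.
  apply/hom_eq/fN/quotient_mapP; exact: quotient_map_repr.
have gM : {morph g : p q / p * q}.
  move=> p q; rewrite -(quotient_map_repr p) -(quotient_map_repr q).
  by rewrite -gmulfM !gE gmulfM.
by exists (hom_of gM).
Qed.

Lemma generated_subgroup (G : groupType) (S : set G) : is_subgroup (generated S).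
Proof.
split=> [N [[]]//|x y Sx Sy N NS|x Sx N NS]; case: (NS) => -[N1 NM NV] _.
  by apply: NM; [exact: Sx | exact: Sy].
by apply: NV; exact: Sx.
Qed.

Lemma generated_sub (G : groupType) (S H : set G) : is_subgroup H ->
  S `<=` H -> generated S `<=` H.
Proof. by move=> sH SH x; apply. Qed.

Lemma sub_generated (G : groupType) (S : set G) : S `<=` generated S.
Proof. by move=> x Sx N [_]; apply. Qed.

(** * Finite quotients in a variety and the pro-topology *)

Section Variety.
Variables (V : group_class) (HV : is_variety V).
Let W := finite_trace V.

Lemma variety_of_kernel (G K : groupType) (f : {multiplicative G -> K}) :
  V K -> V (quotient_group (kernel f)).
Proof.
have [g gE] := @factor_quotient _ _ (kernel f) f (fun x => id).
apply: (variety_sub HV (f := g)) => p q.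
rewrite -(quotient_map_repr p) -(quotient_map_repr q) !gE.
by move=> /quotient_kernelP.
Qed.

Lemma finite_of_kernel (G K : groupType) (f : {multiplicative G -> K}) :
  finite_set [set: K] -> finite_set [set: quotient_group (kernel f)].
Proof.
have [g gE] := @factor_quotient _ _ (kernel f) f (fun x => id).
have ginj : injective g.
  move=> p q; rewrite -(quotient_map_repr p) -(quotient_map_repr q) !gE.
  by move=> /quotient_kernelP.
move=> finK; apply/(finite_preimage (f := g) (B := setT)) => //.
by move=> p q _ _; apply: ginj.
Qed.

Lemma variety_quotient (G : groupType) (N : normal_subgroup G) :
  V G -> V (quotient_group N).
Proof.
apply: (variety_image HV (f := quotient_map N)) => q.
by exists (repr q); exact: quotient_map_repr.
Qed.

Lemma finite_trace_trivial : exists K : groupType, W K.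
Proof.
exists (group_prod (fun i : void => match i with end)); split.
  by apply: (variety_prod HV) => -[].
rewrite (_ : [set: _] = [set 1]); first exact: finite_set1.
by apply/seteqP; split=> // x _; apply: functional_extensionality_dep => -[].
Qed.

(** Two homomorphisms into finite groups of the variety can be replaced by one,
    into the direct product. *)
Lemma finite_trace_pair (G K1 K2 : groupType) (f1 : {multiplicative G -> K1})
    (f2 : {multiplicative G -> K2}) : W K1 -> W K2 ->
  exists (K : groupType) (f : {multiplicative G -> K}), W K /\
    forall x y, f x = f y -> f1 x = f1 y /\ f2 x = f2 y.
Proof.
move=> [V1 fin1] [V2 fin2].
pose F b : groupType := if b then K1 else K2.
pose f x : group_prod F := fun b => if b is true then f1 x else f2 x.
have fM : {morph f : x y / x * y}.
  by move=> x y; apply: functional_extensionality_dep => -[] /=; exact: gmulfM.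
exists (group_prod F), (hom_of fM); split; last first.
  by move=> x y /= fxy; split; [have := congr1 (fun h => h true) fxy
                             | have := congr1 (fun h => h false) fxy].
split; first by apply: (variety_prod HV) => -[].
pose pr (h : group_prod F) : K1 * K2 := (h true, h false).
apply: (@sub_finite_set _ _ (pr @^-1` (setT `*` setT))) => //.
apply: finite_preimage; last exact: finite_setX.
move=> h1 h2 _ _ [e1 e2]; apply: functional_extensionality_dep => -[];
  [exact: e1 | exact: e2].
Qed.

(** The kernels of the homomorphisms into finite groups of the variety form a
    basis of neighbourhoods, because they are closed under intersection. *)
Lemma pro_closureP (G : groupType) (S : set G) x :
  pro_closure W S x <-> forall (K : groupType) (f : {multiplicative G -> K}),
    W K -> exists2 s, S s & f s = f x.
Proof.
split=> [clx K f WK|clx U].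
  have : nbhs (x : pro W G) (f @^-1` [set f x] : set (pro W G)).
    apply: open_nbhs_nbhs; split=> //.
    exists [set (f @^-1` [set f x] : set (pro W G))];
      last by rewrite bigcup_set1.
    move=> _ ->; exists [fset (f @^-1` [set f x] : set (pro W G))]%fset.
      by move=> U /= /fset1P ->; apply/mem_set; exists K, f, [set f x].
    by rewrite set_fset1 bigcap_set1.
  by move=> /clx [s [Ss fs]]; exists s.
rewrite nbhsE => -[O [[D subD <-]] [B DB Bx] OU].
have [E subE defB] := subD B DB.
suff [K [f [WK fE]]] : exists (K : groupType) (f : {multiplicative G -> K}),
    W K /\ forall y U', f y = f x -> U' \in (E : seq _) -> U' y.
  have [s Ss fs] := clx K f WK; exists s; split=> //.
  have Bs : (B : set G) s by rewrite -defB => U' /= EU; apply: fE.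
  by apply: OU; exists B.
have Ex U' : U' \in (E : seq _) -> pro_subbase W U' /\ U' x.
  move=> EU; split; first by exact/set_mem/subE.
  by have : (B : set G) x := Bx; rewrite -defB; apply.
elim: (E : seq _) Ex => [|U1 E' IHE] Ex {subE defB}.
  have [K WK] := finite_trace_trivial.
  by exists K, (hom_of (fun x y : G => esym (mulg1 (1 : K)))).
have [[K1 [f1 [B1 [WK1 defU1]]]] U1x] := Ex U1 (mem_head _ _).
have [U' EU'|K2 [f2 [WK2 f2E]]] := IHE; first by apply: Ex;
  rewrite inE EU' orbT.
have [K [f [WK fE]]] := finite_trace_pair f1 f2 WK1 WK2; exists K, f;
  split=> //.
move=> y U' /fE[f1y f2y]; rewrite inE => /orP[/eqP->|]; last exact: f2E.
by move: U1x; rewrite defU1 /= f1y.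
Qed.

End Variety.

(** * Words and relatively free groups *)

Section Words.
Variable A : choiceType.
Local Notation letter := (A * bool)%type.
Local Notation F := (free_group A).
Implicit Types (l : letter) (w : seq letter) (x y : F).

Definition letter_gen l : F := @FreeGroup A [:: l] isT.

(** The words here need not be reduced, so that they can be concatenated. *)
Definition word_prod w : F := foldr (fun l x => letter_gen l * x) 1 w.

Lemma word_prodK x : word_prod (word x) = x.
Proof.
case: x => w rw; apply/val_inj => /=; rewrite -[RHS](foldr_lmul1 rw).
by elim: w {rw} => //= l w <-.
Qed.

Lemma word_prod_cat u v : word_prod (u ++ v) = word_prod u * word_prod v.
Proof. by elim: u => [|l u IHu] /=; rewrite ?mul1g // IHu mulgA. Qed.

Lemma letter_gen_inv l : letter_gen (letter_inv l) = (letter_gen l)^-1.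
Proof. by apply/val_inj. Qed.

Lemma letter_genE a b :
  letter_gen (a, b) = if b then (free_gen a)^-1 else free_gen a.
Proof. by case: b => //; rewrite -letter_gen_inv. Qed.

Lemma word_prod_inv w :
  word_prod (rev (map (@letter_inv A) w)) = (word_prod w)^-1.
Proof.
elim: w => [|l w IHw]; first by rewrite invg1.
by rewrite /= rev_cons -cats1 word_prod_cat IHw /= mulg1 letter_gen_inv invgM.
Qed.

Lemma word1 x : word x = [::] -> x = 1.
Proof. by move=> x1; apply/val_inj. Qed.

Lemma wordM x y : word (x * y) = foldr (@lmul A) (word y) (word x).
Proof. by []. Qed.

Lemma word_inv x : word x^-1 = rev (map (@letter_inv A) (word x)).
Proof. by []. Qed.

Lemma eq_hom_word (G : groupType) (f g : {multiplicative F -> G}) x :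
  (forall a, a \in map fst (word x) -> f (free_gen a) = g (free_gen a)) ->
  f x = g x.
Proof.
rewrite -[in LHS](word_prodK x) -[in RHS](word_prodK x).
elim: (word x) => [|[a b] w IHw] fg /=; first by rewrite !hom1.
rewrite !gmulfM IHw => [|c cw]; last by apply: fg; rewrite inE cw orbT.
by rewrite letter_genE; case: b fg => fg; rewrite ?homV fg ?mem_head.
Qed.

(** Each element is contained in a free factor of finite rank, which is a
    retract of the free group on the natural numbers. *)
Lemma nat_retract x : exists (i : {multiplicative F -> free_group nat})
  (r : {multiplicative free_group nat -> F}), r (i x) = x.
Proof.
set s := map fst (word x).
exists (free_ext (fun a => free_gen (index a s))).
exists (free_ext (fun n => nth 1 (map (@free_gen A) s) n)).
have id_hom : {morph id : y z / y * z : F} by [].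
apply: (eq_hom_word (f := _ \o _) (g := hom_of id_hom)) => a a_s.
by rewrite /= !free_ext_gen (nth_map a) ?index_mem // nth_index.
Qed.

End Words.

Section RelativelyFree.
Variables (V : group_class) (HV : is_variety V).

Lemma verbal_trivial_image (A : choiceType) (G : groupType)
    (f : {multiplicative free_group A -> G}) : V G ->
  forall x, normal_set (verbal V A) x -> f x = 1.
Proof.
move=> VG x; apply: (@smallest_sub _ _ _ [set x | f x = 1]).
  exact: kernel_normal.
move=> _ [u [phi [Vu ->]]]; exact: (Vu _ VG (f \o phi)).
Qed.

Lemma verbal_separates (A : choiceType) (x : free_group A) :
  ~ normal_set (verbal V A) x ->
  exists (G : groupType) (f : {multiplicative free_group A -> G}),
    V G /\ f x <> 1.
Proof.
move=> nVx; apply: contrapT => noG; apply: nVx.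
have [i [r ri]] := nat_retract x; rewrite -ri => N [_]; apply.
exists (i x), r; split=> // G VG phi; apply: contrapT => phix.
by apply: noG; exists G, (phi \o i).
Qed.

(** The relatively free group embeds into the product of one group of the
    variety for each element outside of the verbal subgroup. *)
Lemma variety_relatively_free (A : choiceType) :
  V (quotient_group (verbal V A)).
Proof.
pose I := {x : free_group A | ~ normal_set (verbal V A) x}.
have sep (i : I) : {G : groupType & {f : {multiplicative free_group A -> G} |
    V G /\ f (proj1_sig i) <> 1}}.
  by have [G /cid [f fi]] := cid (verbal_separates (proj2_sig i)); exists G, f.
pose G i := projT1 (sep i).
pose f i : {multiplicative free_group A -> G i} := proj1_sig (projT2 (sep i)).
have VG i : V (G i) by case: (proj2_sig (projT2 (sep i))).
have fi i : f i (proj1_sig i) <> 1 by case: (proj2_sig (projT2 (sep i))).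
pose h x : group_prod G := fun i => f i x.
have hM : {morph h : x y / x * y}.
  by move=> x y; apply: functional_extensionality_dep => i; exact: gmulfM.
have [|g gE] := @factor_quotient _ _ (verbal V A) (hom_of hM).
  move=> x Vx; apply: functional_extensionality_dep => i.
  exact: (verbal_trivial_image (f i) (VG i)).
apply: (variety_sub HV (f := g)); last exact: (variety_prod HV VG).
move=> p q;
  rewrite -(quotient_map_repr p) -(quotient_map_repr q) !gE => /hom_eq.
set x := _ * _ => hx; apply/quotient_mapP; apply: contrapT => nVx.
exact: (fi (exist _ x nVx) (congr1 (fun k => k (exist _ x nVx : I)) hx)).
Qed.

(** A homomorphism from the free group to a group of the variety factors through
    the relatively free group; conversely the image of a finite quotient of the
    relatively free group is in the variety. *)
Lemma pro_closure_relatively_free (A : choiceType) (H : set (free_group A)) :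
  let pi := quotient_map (verbal V A) in
  pro_closure (finite_trace V) H = pi @^-1` pro_closure finite_groups (pi @` H).
Proof.
move=> pi.
have -> : finite_groups = finite_trace (fun=> True).
  by apply/funext => G; apply/propext; split=> [|[]].
have HT : is_variety (fun=> True) by split.
apply/seteqP; split=> x.
  move=> /(pro_closureP HV) clx; apply/(pro_closureP HT) => K f [_ finK].
  pose f' := quotient_map (kernel f) \o pi.
  have [|h Hh /quotient_kernelP fh] := clx _ (quotient_map (kernel f) \o pi).
    split; first by apply: variety_quotient => //;
      exact: variety_relatively_free.
    exact: finite_of_kernel.
  by exists (pi h) => //; exists h.
move=> /(pro_closureP HT) clx; apply/(pro_closureP HV) => K f [VK finK].
have [g gE] := factor_quotient (verbal_trivial_image f VK).
by have [//|_ [h Hh <-]] := clx K g; rewrite !gE; exists h.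
Qed.

Lemma verbal_sub_pro_closure (A : choiceType) (H : set (free_group A)) :
  set_prod H (normal_set (verbal V A)) `<=` pro_closure (finite_trace V) H.
Proof.
move=> _ [h [n [Hh Nn ->]]]; apply/(pro_closureP HV) => K f [VK _].
by exists h; rewrite // gmulfM (verbal_trivial_image f VK Nn) mulg1.
Qed.

Lemma pro_closure_subgroup (G : groupType) (H : set G) : is_subgroup H ->
  is_subgroup (pro_closure (finite_trace V) H).
Proof.
move=> [H1 HM HinvV]; split.
- by apply/(pro_closureP HV) => K f _; exists 1.
- move=> x y /(pro_closureP HV) clx /(pro_closureP HV) cly.
  apply/(pro_closureP HV) => K f WK.
  have [[h Hh hx] [k Hk ky]] := (clx K f WK, cly K f WK).
  by exists (h * k); [exact: HM | rewrite !gmulfM hx ky].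
- move=> x /(pro_closureP HV) clx; apply/(pro_closureP HV) => K f WK.
  have [h Hh hx] := clx K f WK.
  by exists h^-1; [exact: HinvV | rewrite !homV hx].
Qed.

Lemma sub_pro_closure (G : groupType) (H : set G) :
  H `<=` pro_closure (finite_trace V) H.
Proof. by move=> x Hx; apply/(pro_closureP HV) => K f _; exists x. Qed.

Lemma pro_closedP (G : groupType) (H : set G) :
  pro_closed (finite_trace V) H <-> pro_closure (finite_trace V) H `<=` H.
Proof.
split=> [/closure_id/esym clH|clH]; first by rewrite /pro_closure clH.
by move=> x clx; apply: clH.
Qed.

End RelativelyFree.

(** * Coset representatives and partial coset actions *)

Lemma perm_extension (T : finType) (D : {set T}) (f : T -> T) :
  {in D &, injective f} -> exists s : {perm T}, {in D, s =1 f}.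
Proof.
move=> finj; pose E := f @: D.
have eqC : size (enum (~: E)) = size (enum (~: D)).
  by rewrite -!cardE cardsCs finset.setCK [RHS]cardsCs finset.setCK card_in_imset.
pose g x := if x \in D then f x else nth x (enum (~: E)) (index x (enum (~: D))).
have idx x : x \notin D -> (index x (enum (~: D)) < size (enum (~: E)))%N.
  by move=> xD; rewrite eqC index_mem mem_enum inE.
have gE x : x \notin D -> g x \notin E.
  move=> xD; rewrite /g (negbTE xD).
  by have := mem_nth x (idx x xD); rewrite mem_enum inE.
have ginj : injective g.
  move=> x y gxy; have [xD|xD] := boolP (x \in D);
    have [yD|yD] := boolP (y \in D).
  - by move: gxy; rewrite /g xD yD; apply: finj.
  - by have := gE y yD; rewrite -gxy /g xD imset_f.
  - by have := gE x xD; rewrite gxy /g yD imset_f.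
  move: gxy; rewrite /g (negbTE xD) (negbTE yD) (set_nth_default y) ?idx //.
  move=> /eqP; rewrite nth_uniq ?idx ?enum_uniq // => /eqP.
  have memC z : z \notin D -> z \in enum (~: D) by move=> zD;
    rewrite mem_enum inE.
  by move=> e; rewrite -(nth_index x (memC x xD)) e nth_index ?memC.
by exists (perm ginj) => x xD; rewrite permE /g xD.
Qed.

Section Cosets.
Variables (A : choiceType) (H : set (free_group A)).
Hypothesis HH : is_subgroup H.
Local Notation F := (free_group A).
Local Notation letter := (A * bool)%type.
Implicit Types (x y p : F) (X : seq F) (l : letter) (u v w : seq letter).

Let H1 : H 1. Proof. by case: HH. Qed.
Let HM x y : H x -> H y -> H (x * y). Proof. by case: HH => _ + _; apply. Qed.
Let HV x : H x -> H x^-1. Proof. by case: HH => _ _; apply. Qed.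

(** The right coset [H x] is replaced by a chosen element of it, so that finite
    sets of cosets are sequences in a type with decidable equality. *)
Definition coset_rep x : F := xget 1 [set y | H (x * y^-1)].

Lemma coset_repP x : H (x * (coset_rep x)^-1).
Proof. by apply: (@xgetPex _ 1 [set y | H (x * y^-1)]); exists x;
  rewrite /= mulgV. Qed.

Lemma eq_coset_rep x y : coset_rep x = coset_rep y <-> H (x * y^-1).
Proof.
split=> [xy|Hxy].
  have := HM (coset_repP x) (HV (coset_repP y)).
  by rewrite xy invgM invgK mulgA mulgVK.
rewrite /coset_rep; congr xget; apply/seteqP; split=> z /= Hz.
  by have := HM (HV Hxy) Hz; rewrite invgM invgK mulgA mulgVK.
by have := HM Hxy Hz; rewrite mulgA mulgVK.
Qed.

Lemma coset_rep_id x : coset_rep (coset_rep x) = coset_rep x.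
Proof. by apply/eq_coset_rep; have := HV (coset_repP x);
  rewrite invgM invgK. Qed.

Lemma coset_repMr x y z : coset_rep x = coset_rep y ->
  coset_rep (x * z) = coset_rep (y * z).
Proof.
by move=> /eq_coset_rep Hxy; apply/eq_coset_rep; rewrite invgM mulgA mulgK.
Qed.

Lemma coset_rep_mul x z : coset_rep (coset_rep x * z) = coset_rep (x * z).
Proof. exact/coset_repMr/coset_rep_id. Qed.

Lemma coset_rep_mem x : coset_rep x = coset_rep 1 <-> H x.
Proof. by rewrite eq_coset_rep invg1 mulg1. Qed.

(** The path labelled [w] from the vertex [H x] of the Schreier coset graph stays
    in [X]. The initial vertex is given by any of its elements, so that paths can
    be composed by multiplication. *)
Definition path_in X x w :=
  forall i, coset_rep (x * word_prod (take i w)) \in X.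

Lemma path_in_nil X x : path_in X x [::] <-> coset_rep x \in X.
Proof. by split=> [/(_ 0)|xX i]; rewrite /= mulg1. Qed.

Lemma path_in_cons X x l w : path_in X x (l :: w) <->
  coset_rep x \in X /\ path_in X (x * letter_gen l) w.
Proof.
split=> [xlw|[xX xlw] [|i]] /=; rewrite ?mulg1 ?mulgA //.
split=> [|i]; first by have := xlw 0; rewrite /= mulg1.
by have := xlw i.+1; rewrite /= mulgA.
Qed.

Lemma path_in_cat X x u v : path_in X x (u ++ v) <->
  path_in X x u /\ path_in X (x * word_prod u) v.
Proof.
elim: u x => [|l u IHu] x /=; rewrite ?mulg1.
  by split=> [xv|[]//]; split=> //; apply/path_in_nil; have := xv 0;
    rewrite /= take0 mulg1.
by rewrite !path_in_cons IHu mulgA; tauto.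
Qed.

Lemma path_in_rep X x y w : coset_rep x = coset_rep y ->
  path_in X x w -> path_in X y w.
Proof. by move=> xy xw i; rewrite -(coset_repMr _ xy). Qed.

Lemma path_in_sub X Y x w : {subset X <= Y} -> path_in X x w -> path_in Y x w.
Proof. by move=> XY xw i; apply/XY/xw. Qed.

Lemma path_in_last X x w : path_in X x w -> coset_rep (x * word_prod w) \in X.
Proof. by move=> /(_ (size w)); rewrite take_size. Qed.

Lemma path_in_inv X x w : path_in X x w ->
  path_in X (x * word_prod w) (rev (map (@letter_inv A) w)).
Proof.
elim: w x => [|l w IHw] x; first by rewrite /= mulg1.
rewrite path_in_cons => -[xX /IHw]; rewrite /= rev_cons -cats1 -mulgA => xw.
apply/path_in_cat; split=> //.
rewrite word_prod_inv mulgA mulgK; apply/path_in_cons.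
rewrite path_in_nil letter_gen_inv mulgK; split=> //.
by have := path_in_last xw; rewrite word_prod_inv mulgA mulgK.
Qed.

(** Cancelling a letter against its inverse removes a spur of the path. *)
Lemma path_in_reduce X x u v :
  path_in X x (u ++ v) -> path_in X x (foldr (@lmul A) v u).
Proof.
elim: u x => //= l u IHu x /path_in_cons[xX /IHu].
case: (foldr _ _ _) => [|m w] /=; first by rewrite path_in_cons.
case: eqP => [->|_] xmw; last by rewrite path_in_cons.
by move: xmw; rewrite path_in_cons letter_gen_inv mulgK => -[].
Qed.

(** The elements whose reduced words label loops in [X] at the base vertex form a
    subgroup. Hence reading an element of [H] never leaves the finite graph that
    the generators span, although the element can be arbitrarily long. *)
Lemma generated_path_in X (ws : seq F) : H = generated [set` ws] ->
  coset_rep 1 \in X -> (forall x, x \in ws -> path_in X 1 (word x)) ->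
  forall h, H h -> path_in X 1 (word h).
Proof.
move=> defH X1 Xws h; rewrite defH => Hh.
suff [] : [set h | H h /\ path_in X 1 (word h)] h by [].
apply: Hh; split=> [|w /= w_ws].
  split=> [|x y [Hx Xx] [Hy Xy]|x [Hx Xx]] /=.
  - by split=> //; apply/path_in_nil.
  - split; first exact: HM.
    apply: path_in_reduce; apply/path_in_cat; split=> //; rewrite word_prodK.
    by apply: path_in_rep Xy; rewrite mul1g; apply/esym/coset_rep_mem.
  - split; first exact: HV.
    have := path_in_inv Xx; rewrite word_prodK mul1g.
    by apply: path_in_rep; apply/coset_rep_mem.
by split; [rewrite defH; apply: sub_generated | exact: Xws].
Qed.

(** The vertices of the Stallings graph of the subgroup generated by [ws]. *)
Definition prefix_reps (ws : seq F) : seq F := undup (coset_rep 1 ::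
  flatten [seq [seq coset_rep (word_prod (take i.+1 (word x))) |
                i <- iota 0 (size (word x))] | x <- ws]).

Lemma size_prefix_reps ws :
  (size (prefix_reps ws) <= (sumn [seq size (word x) | x <- ws]).+1)%N.
Proof.
apply: leq_trans (size_undup _) _; rewrite /= size_flatten /shape -map_comp.
by rewrite (eq_map (g := fun x : F => size (word x))) // => x /=;
  rewrite size_map size_iota.
Qed.

Lemma prefix_reps1 ws : coset_rep 1 \in prefix_reps ws.
Proof. by rewrite mem_undup mem_head. Qed.

Lemma path_in_prefix_reps ws x :
  x \in ws -> path_in (prefix_reps ws) 1 (word x).
Proof.
move=> x_ws; set w := word x; suff takeX i : (i <= size w)%N ->
    coset_rep (word_prod (take i (w))) \in prefix_reps ws.
  move=> i; rewrite mul1g; case: (leqP i (size w)) => [/takeX//|wi].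
  by rewrite take_oversize ?(ltnW wi) // -[w]take_size takeX.
case: i => [|i] iw; first by rewrite take0 prefix_reps1.
rewrite mem_undup inE; apply/orP; right; apply/flattenP.
by eexists; [apply: map_f x_ws | apply: (map_f (fun i => _)); rewrite mem_iota].
Qed.

(** Finite connected subgraphs of the coset graph at the base vertex. *)
Definition connected X := [/\ uniq X, coset_rep 1 \in X &
  forall p, p \in X -> exists2 w, path_in X 1 w & coset_rep (word_prod w) = p].

Lemma connected_prefix_reps ws : connected (prefix_reps ws).
Proof.
split=> [||p]; [exact: undup_uniq | exact: prefix_reps1 |].
rewrite mem_undup inE => /orP[/eqP->|/flattenP[_ /mapP[x x_ws ->]]].
  by exists [::] => //; apply/path_in_nil/prefix_reps1.
move=> /mapP[i _ ->]; exists (take i.+1 (word x)) => // j.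
by rewrite -take_min; apply: path_in_prefix_reps.
Qed.

Lemma connected_full X : coset_rep 1 \in X ->
  (forall p l, p \in X -> coset_rep (p * letter_gen l) \in X) ->
  forall x, coset_rep x \in X.
Proof.
move=> X1 XS x; rewrite -[x]mul1g -[x]word_prodK.
elim: (word x) 1 X1 => [|l w IHw] y yX; first by rewrite /= mulg1.
by rewrite /= mulgA; apply: IHw; rewrite -coset_rep_mul XS.
Qed.

(** A connected set of vertices that no letter leads out of is the whole graph;
    any other one can be enlarged by one vertex. *)
Lemma connected_grow X n : connected X -> (size X <= n)%N ->
  exists2 Y, connected Y & [/\ {subset X <= Y}, (size Y <= n)%N &
    size Y = n \/ forall x, coset_rep x \in Y].
Proof.
move=> cX Xn; elim: {Xn}(n - size X)%N {-2}X (subnKC Xn) cX => [|m IHm] {}X.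
  by rewrite addn0 => Xn cX; exists X => //; split; rewrite ?Xn //; left.
move=> Xn cX; have [uX X1 XP] := cX.
have [full|] := pselect (forall p l, p \in X -> coset_rep (p * letter_gen l) \in X).
  exists X => //; split=> //; first by rewrite -Xn leq_addr.
  by right; apply: connected_full.
move=> /existsNP[p /existsNP[l /not_implyP[pX /negP plX]]].
have sub_rcons : {subset X <= rcons X (coset_rep (p * letter_gen l))}.
  by move=> y yX; rewrite mem_rcons inE yX orbT.
have [||Y cY [XY Yn YE]] := IHm (rcons X (coset_rep (p * letter_gen l))).
- by rewrite size_rcons addSnnS.
- split; [by rewrite rcons_uniq plX | exact: sub_rcons |].
  move=> q; rewrite mem_rcons inE => /orP[/eqP->|/XP[w Xw <-]]; last first.
    by exists w => //; apply: path_in_sub Xw.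
  have [w Xw wp] := XP p pX; exists (w ++ [:: l]); last first.
    by rewrite word_prod_cat -coset_rep_mul wp /= mulg1.
  apply/path_in_cat; split; first exact: path_in_sub Xw.
  rewrite mul1g; apply/path_in_cons; rewrite path_in_nil wp sub_rcons //.
  by rewrite -coset_rep_mul wp mem_rcons mem_head.
- by exists Y => //; split=> // y yX; apply/XY/sub_rcons.
Qed.

(** Where a generator does not lead out of [X], it acts injectively on [X]; this
    partial injection extends to a permutation of any larger finite set. *)
Lemma partial_action X n : uniq X -> {in X, forall p, coset_rep p = p} ->
  (size X <= n)%N ->
  exists r : {multiplicative F -> {perm 'I_n}},
    forall (w : seq letter) x (i : 'I_n), path_in X x w ->
      i = index (coset_rep x) X :> nat ->
      r (word_prod w) i = index (coset_rep (x * word_prod w)) X :> nat.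
Proof.
move=> uX repX Xn.
pose img (a : A) (i : 'I_n) := coset_rep (nth 1 X i * free_gen a).
pose D a := [set i : 'I_n | (i < size X)%N && (img a i \in X)]%SET.
have step a : exists s : {perm 'I_n}, forall i, i \in D a ->
    s i = index (img a i) X :> nat.
  pose f (i : 'I_n) := insubd i (index (img a i) X).
  have fE i : i \in D a -> f i = index (img a i) X :> nat.
    rewrite inE => /andP[_ iX]; rewrite val_insubd.
    by rewrite (leq_trans _ Xn) // index_mem.
  have [|s sf] := @perm_extension _ (D a) f; last first.
    by exists s => i iD; rewrite sf // fE.
  move=> i j iD jD /(congr1 val); rewrite /= !fE //.
  move: iD jD; rewrite !inE => /andP[iX aiX] /andP[jX ajX].
  move=> eidx; have : img a i = img a j.
    by rewrite -(nth_index 1 aiX) eidx nth_index.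
  move=> /(coset_repMr (free_gen a)^-1); rewrite !mulgK.
  rewrite !repX ?mem_nth // => /eqP; rewrite nth_uniq // => /eqP.
  exact: val_inj.
pose s a := sval (cid (step a)); 
  pose r : {multiplicative F -> {perm 'I_n}} := free_ext s.
have sE a i : i \in D a -> s a i = index (img a i) X :> nat.
  by rewrite /s; case: (cid _) => /= t; apply.
have rgen a x (i : 'I_n) : coset_rep x \in X -> coset_rep (x * free_gen a) \in X ->
    i = index (coset_rep x) X :> nat ->
    s a i = index (coset_rep (x * free_gen a)) X :> nat.
  move=> xX xaX ix; have imgE : img a i = coset_rep (x * free_gen a).
    by rewrite /img ix nth_index // coset_rep_mul.
  by rewrite sE ?imgE // inE imgE xaX ix index_mem xX.
have rletter l x (i : 'I_n) : coset_rep x \in X -> coset_rep (x * letter_gen l) \in X ->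
    i = index (coset_rep x) X :> nat ->
    r (letter_gen l) i = index (coset_rep (x * letter_gen l)) X :> nat.
  case: l => a b xX; rewrite letter_genE; case: b => xaX ix; last first.
    by rewrite [r _](free_ext_gen s); apply: rgen.
  have jn : (index (coset_rep (x * (free_gen a)^-1)%g) X < n)%N.
    by rewrite (leq_trans _ Xn) // index_mem.
  rewrite homV [r _](free_ext_gen s) -[RHS]/(nat_of_ord (Ordinal jn));
    congr val.
  apply: (canLR (permK (s a))); apply: val_inj => /=.
  by rewrite (rgen a (x * (free_gen a)^-1)) ?mulgVK.
exists r => w; elim: w => [|l w IHw] x i.
  by rewrite /= hom1 perm1 mulg1.
rewrite path_in_cons => -[xX xlw] ix /=; rewrite gmulfM permM mulgA.
have xlX : coset_rep (x * letter_gen l) \in X.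
  by have := xlw 0; rewrite take0 /= mulg1.
by apply: IHw => //; apply: rletter.
Qed.

End Cosets.

(** * Separation of finitely generated subgroups *)

Lemma reduced_cat_cons (A : choiceType) (u v : seq (A * bool)) l :
  reduced (u ++ l :: v) = reduced (rcons u l) && reduced (l :: v).
Proof.
by case: u => //= m u; rewrite /reduced /= cat_path rcons_path /= andbA.
Qed.

Lemma word_word_prod (A : choiceType) (w : seq (A * bool)) :
  reduced w -> word (word_prod w) = w.
Proof.
move=> rw; rewrite -[RHS](foldr_lmul1 rw) {rw}; elim: w => //= l w <-.
by case: (word_prod w).
Qed.

Lemma reduced_rcons (A : choiceType) (u : seq (A * bool)) l : reduced u ->
  (u = [::] \/ l <> letter_inv (last l u)) -> reduced (rcons u l).
Proof.
case: u => //= m u ru [//|/eqP lu].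
by rewrite /reduced /= rcons_path lu andbT.
Qed.

Lemma perm_intertwine (A : choiceType) (T X : finType)
    (f : {multiplicative free_group A -> {perm X}})
    (r : {multiplicative free_group A -> {perm T}}) (h : T -> X) x :
  (forall a, a \in map fst (word x) ->
    forall t, f (free_gen a) (h t) = h (r (free_gen a) t)) ->
  forall t, f x (h t) = h (r x t).
Proof.
rewrite -{2 3}[x]word_prodK; elim: (word x) => [|[a b] w IHw] fr t.
  by rewrite !hom1 !perm1.
rewrite /= !gmulfM !permM -IHw => [|c cw]; last by apply: fr;
  rewrite inE cw orbT.
congr (_ _); have {}fr := fr a (mem_head _ _).
rewrite letter_genE; case: b; rewrite // !homV.
by apply: (canLR (permK _)); rewrite fr permKV.
Qed.

Section Separation.
Variable A : choiceType.
Local Notation F := (free_group A).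
Implicit Types (x y g : F) (ws : seq F).

Lemma connected_rep (H : set F) X : is_subgroup H -> connected H X ->
  {in X, forall p, coset_rep H p = p}.
Proof. by move=> HH [_ _ XP] p /XP[w _ <-]; apply: coset_rep_id. Qed.

(** Marshall Hall's theorem: the paths of the generators and of [x] in the coset
    graph span a finite partial action, which extends to a finite action. *)
Lemma hall_separation (ws : seq F) x : ~ generated [set` ws] x ->
  exists n (r : {multiplicative F -> {perm 'I_n}}) (i : 'I_n),
    (forall h, generated [set` ws] h -> r h i = i) /\ r x i <> i.
Proof.
set H := generated _ => nHx;
  have HH : is_subgroup H by exact: generated_subgroup.
pose X := prefix_reps H (x :: ws).
have cX : connected H X by exact: connected_prefix_reps.
have [uX X1 _] := cX.
have [r rE] := partial_action HH uX (connected_rep HH cX) (leqnn (size X)).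
have iX : (index (coset_rep H 1%g) X < size X)%N by rewrite index_mem.
exists (size X), r, (Ordinal iX).
have rpath y : path_in H X 1 (word y) ->
    r y (Ordinal iX) = index (coset_rep H y) X :> nat.
  by move=> Xy; have := rE _ 1 (Ordinal iX) Xy erefl; rewrite word_prodK mul1g.
split=> [h Hh|rx].
  apply: val_inj; rewrite /= rpath;
    first by rewrite (proj2 (coset_rep_mem HH h)).
  apply: (generated_path_in HH erefl) => // y y_ws.
  by apply: path_in_prefix_reps; rewrite inE y_ws orbT.
have Xx : path_in H X 1 (word x) by apply: path_in_prefix_reps;
  rewrite mem_head.
apply: nHx; apply/(coset_rep_mem HH).
have xX : coset_rep H x \in X.
  by have := path_in_last Xx; rewrite word_prodK mul1g.
have := rpath x Xx; rewrite rx /= => e.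
by rewrite -(nth_index 1 xX) -e nth_index.
Qed.

(** * Subgroups containing a nontrivial normal subgroup *)

Lemma nontrivial_power_prefix (S : set F) : is_subgroup S ->
  (forall a b : A, a = b) -> forall w, S w -> w <> 1 ->
  forall g, exists2 s, S s & exists v, word s = word g ++ v.
Proof.
move=> [S1 SM SV] A1 w Sw w1 g.
have [->|] := eqVneq (word g) [::]; first by exists w => //; exists (word w).
have constant x : word x <> [::] -> exists n l, word x = nseq n.+1 l.
  case: x => -[//|l u] /= rlu _; exists (size u), l; congr (_ :: _).
  elim: u l rlu => //= m u IHu l /andP[ml /IHu um].
  suff -> : l = m by rewrite -um.
  case: l m ml {um IHu} => [a b] [c d]; rewrite /letter_inv /= (A1 a c).
  by case: b; case: d; rewrite ?eqxx.
move=> /eqP/constant[n [l gE]].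
have [k [m wE]] : exists k m, word w = nseq k.+1 m.
  by apply: constant => /word1.
have [x Sx [j xE]] : exists2 x, S x & exists j, word x = nseq j.+1 l.
  have [lm|lm] := eqVneq l m; first by exists w => //; exists k; rewrite lm.
  exists w^-1; first exact: SV.
  exists k; rewrite word_inv wE map_nseq rev_nseq; congr nseq.
  case: l m lm {gE wE} => [a b] [c d]; rewrite /letter_inv /= (A1 a c).
  by case: b; case: d; rewrite ?eqxx.
exists (x ^+ n.+1).
  by elim: n.+1 => [|i IHi]; rewrite ?expg0 // expgS; apply: SM.
exists (nseq (j * n.+1) l).
rewrite gE -nseqD -{1}[x]word_prodK xE -mulSn.
have -> i : word_prod (nseq j.+1 l) ^+ i = word_prod (nseq (j.+1 * i) l).
  elim: i => [|i IHi]; first by rewrite muln0.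
  by rewrite expgS IHi -word_prod_cat -nseqD mulnS.
rewrite word_word_prod //; case: (j.+1 * n.+1)%N => //= i.
elim: i => //= i; rewrite /reduced /= => ->; rewrite andbT.
by case: (l) => a []; rewrite /letter_inv xpair_eqE eqxx.
Qed.

(** If [c] is a letter such that [g c] and [c w c^-1] are reduced as written,
    then so is the conjugate [g c w c^-1 g^-1], of which [g] is a prefix. There
    is such a letter unless there is only one generator. *)
Lemma nontrivial_prefix (S : set F) : is_subgroup S ->
  (is_normal S \/ forall a b : A, a = b) -> forall w, S w -> w <> 1 ->
  forall g, exists2 s, S s & exists v, word s = word g ++ v.
Proof.
move=> SS; have [A1 _|] := pselect (forall a b : A, a = b).
  exact: nontrivial_power_prefix.
move=> /existsNP[a /existsNP[b /eqP ab]] [|//] [_ SJ] w Sw w1 g.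
case wE: (word w) => [|l u]; first by case: w1; exact: word1.
have [c] : exists c, c \notin
    [:: letter_inv l; last l u; letter_inv (last (letter_inv l) (word g))].
  pose cs := [:: (a, false); (a, true); (b, false); (b, true)].
  apply: contrapT => noc; set bad := [:: _; _; _] in noc.
  have /uniq_leq_size : uniq cs.
    by rewrite /= !inE !xpair_eqE !eqxx (negbTE ab).
  have cbad : {subset cs <= bad}.
    by move=> c _; apply: contrapT => /negP cb; apply: noc; exists c.
  by move=> /(_ _ cbad).
rewrite !inE !negb_or => /and3P[cl cu cg].
pose z := word_prod (rcons (word g) c).
exists (w ^ z^-1); first exact: SJ.
exists (c :: word w ++ rev (map (@letter_inv A) (rcons (word g) c))).
have gc : reduced (rcons (word g) c).
  apply: reduced_rcons; first exact: (valP g).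
  case: (word g) cg => [|m v]; first by left.
  by move=> /eqP cg; right.
rewrite -[RHS]word_word_prod.
  congr word; rewrite /conjg invgK -cat_rcons !word_prod_cat word_prod_inv.
  by rewrite word_prodK mulgA.
rewrite reduced_cat_cons gc map_rcons rev_rcons andTb.
have := reduced_inv gc; rewrite map_rcons rev_rcons => gc'.
rewrite -cat_cons reduced_cat_cons gc' andbT.
apply: reduced_rcons; last right.
  have := valP w; rewrite /= wE /reduced /= => ->; rewrite andbT.
  by apply: contra cl => /eqP ->; rewrite letter_invK.
rewrite wE /= => /(congr1 (@letter_inv A)); rewrite !letter_invK => cE.
by rewrite cE eqxx in cu.
Qed.

(** Every [g] is a prefix of an element of the subgroup, so its coset is among the
    finitely many vertices of the Stallings graph. In particular the index is
    finite, with an explicit bound. *)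
Lemma full_prefix_reps (S : set F) ws : is_subgroup S ->
  (is_normal S \/ forall a b : A, a = b) -> (exists2 w, S w & w <> 1) ->
  S `<=` generated [set` ws] ->
  forall g, coset_rep (generated [set` ws]) g \in
            prefix_reps (generated [set` ws]) ws.
Proof.
move=> SS nS [w Sw w1] SH g; set H := generated _.
have HH : is_subgroup H by exact: generated_subgroup.
have [s Ss [v sE]] := nontrivial_prefix SS nS Sw w1 g.
have := generated_path_in HH erefl (prefix_reps1 H ws) (@path_in_prefix_reps _ H ws)
  (SH _ Ss) (size (word g)).
by rewrite sE take_size_cat // word_prodK mul1g.
Qed.

(** Conjugating by a letter that does not occur in [w] gives a reduced word with
    that letter. *)
Lemma normal_all_letters (S : set F) ws (B : set A) : is_normal S ->
  (exists2 w, S w & w <> 1) -> S `<=` generated [set` ws] -> words_over B ws ->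
  forall a, B a.
Proof.
move=> [_ SJ] [w Sw w1] SH wsB a.
have HB : generated [set` ws] `<=` [set h | forall l, l \in word h -> B l.1].
  apply: generated_sub => [|x xws]; last exact: wsB.
  split=> [//|x y xB yB l|x xB l].
    rewrite wordM => lxy; have : l \in word x ++ word y.
      elim: (word x) lxy {xB} => //= m u IHu lu; rewrite inE.
      case: (foldr _ _ _) lu IHu => [|m' v] /=; first by rewrite inE => ->.
      case: ifP => [_ lv IH|_]; first by rewrite IH ?orbT // inE lv orbT.
      by rewrite inE => /orP[->//|lv ->]; rewrite ?orbT.
    by rewrite mem_cat => /orP[]; [exact: xB | exact: yB].
  rewrite word_inv mem_rev => /mapP[m mx ->]; exact: (xB m mx).
apply: contrapT => nBa.
have wB l : l \in word w -> B l.1 by apply: (HB w); exact: SH.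
have Hs := SH _ (SJ w (free_gen a) Sw).
have sE : word (w ^ free_gen a) = (a, true) :: word w ++ [:: (a, false)].
  have -> : w ^ free_gen a = word_prod ((a, true) :: word w ++ [:: (a, false)]).
    by rewrite /= word_prod_cat word_prodK /= mulg1 !letter_genE.
  apply: word_word_prod.
  case wE: (word w) wB => [|l u] wB; first by case: w1; exact: word1.
  rewrite -cat_cons cats1; apply: reduced_rcons; last right.
    have := valP w; rewrite /= wE /reduced /= => ->; rewrite andbT.
    by apply/eqP => lE; apply: nBa; have := wB l (mem_head _ _); rewrite lE.
  move=> /(congr1 fst) /= aE; apply: nBa; rewrite aE; apply: wB.
  exact: mem_last.
by have := HB _ Hs (a, false);
  rewrite sE inE mem_cat !inE eqxx !orbT => /(_ isT).
Qed.

End Separation.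

(** * Verbal subgroups *)

Section Verbal.
Variables (V : group_class) (HV : is_variety V).

(** If the verbal subgroup is trivial then the free group and hence all its
    quotients are in the variety, and Hall's theorem applies. *)
Lemma verbal_trivial_closed (A : choiceType) (ws : seq (free_group A)) :
  normal_set (verbal V A) `<=` [set 1] ->
  pro_closure (finite_trace V) (generated [set` ws]) `<=` generated [set` ws].
Proof.
move=> triv x /(pro_closureP HV) clx; apply: contrapT => nHx.
have VF : V (free_group A).
  apply: (variety_sub HV (f := quotient_map (verbal V A))); last first.
    exact: variety_relatively_free.
  move=> y z /quotient_mapP/triv/(congr1 (fun t => y * t)).
  by rewrite mulVKg mulg1.
have [n [r [i [rH rx]]]] := hall_separation nHx.
have [|h Hh /quotient_kernelP rh] := clx _ (quotient_map (kernel r)).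
  by split; [exact: variety_quotient | apply: finite_of_kernel; exact: finite_finset].
by apply: rx; rewrite -rh rH.
Qed.

Lemma verbal_trivial_of_all (A : choiceType) : (forall G, V G) ->
  normal_set (verbal V A) `<=` [set 1].
Proof.
move=> Vall x Vx; have idM : {morph @id (free_group A) : y z / y * z} by [].
exact: (verbal_trivial_image (hom_of idM) (Vall _) Vx).
Qed.

(** The group [G] is a quotient of the free group on its elements, which belongs
    to the variety if its verbal subgroup is trivial. *)
Lemma all_of_no_identities : identities V `<=` [set 1] -> forall G, V G.
Proof.
move=> noid G; pose ev := free_ext (@id G).
apply: (variety_image HV (f := ev)) => [y|].
  by exists (free_gen y); exact: free_ext_gen.
apply: (variety_sub HV (f := quotient_map (verbal V G))); last first.
  exact: variety_relatively_free.
move=> x y /quotient_mapP Vxy; suff : x^-1 * y = 1.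
  by move=> /(congr1 (fun t => x * t)); rewrite mulVKg mulg1.
move: Vxy; apply: (@smallest_sub _ _ _ [set 1]).
  split; first split=> [//|z t /= -> ->|z /= ->]; rewrite ?mulg1 ?invg1 //.
  by move=> z g /= ->; rewrite conj1g.
by move=> _ [u [phi [/noid -> ->]]]; rewrite hom1.
Qed.

(** The free group of countable rank embeds into the free group on [a] and [b]
    by sending the generator [m] to [a^m b a^-m]. If [u] acts nontrivially on a
    finite set [T], this is seen on a cyclic sequence of copies of [T], which [a]
    rotates and in which [b] acts on the copy [m] like the generator [m]. *)
Lemma nat_embedding (A : choiceType) (a b : A) (u : free_group nat) :
  a <> b -> u <> 1 ->
  exists phi : {multiplicative free_group nat -> free_group A}, phi u <> 1.
Proof.
move=> /eqP ab u1.
pose phi : {multiplicative free_group nat -> free_group A} :=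
  free_ext (fun m => (free_gen b) ^ (free_gen a) ^- m).
exists phi.
have [|n [r [i [_ ru]]]] := @hall_separation _ [::] u.
  by move=> /(_ [set 1]) /= Hu; apply: u1; apply: Hu; split=> [|//];
    split=> [//|x y -> ->|x ->]; rewrite ?mulg1 ?invg1.
pose N := sumn (map fst (word u)).
have alphaI : injective (fun p : 'I_N.+1 * 'I_n => (ordS p.1, p.2)).
  by move=> [k t] [k' t'] /= [kk' ->]; congr (_, _); apply: ordS_inj;
    exact: val_inj.
have betaI : injective (fun p : 'I_N.+1 * 'I_n => (p.1, r (free_gen (p.1 : nat)) p.2)).
  by move=> [k t] [k' t'] /= [<-] /perm_inj ->.
pose f : {multiplicative _ -> _} := free_ext (fun c =>
  if c == a then perm alphaI else if c == b then perm betaI else 1).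
have fa m t : (m <= N)%N -> f (free_gen a ^+ m) (ord0, t) = (inord m, t).
  elim: m => [|m IHm] mN.
    by rewrite expg0 hom1 perm1; congr (_, _); apply: val_inj;
      rewrite /= inordK.
  rewrite expgSr gmulfM permM IHm ?(ltnW mN) // [f _](free_ext_gen _ a) eqxx.
  rewrite permE /=; congr (_, _); apply: val_inj => /=.
  by rewrite !inordK ?modn_small // ltnS ltnW.
have fphi m : m \in map fst (word u) -> forall t,
    (f \o phi) (free_gen m) (ord0, t) = (ord0, r (free_gen m) t).
  move=> mu t; have mN : (m <= N)%N.
    rewrite /N; elim: (map fst _) mu => //= k l IHl; rewrite inE.
    by move=> /orP[/eqP->|/IHl ml];
      [exact: leq_addr | rewrite (leq_trans ml) ?leq_addl].
  have fb : f (free_gen b) = perm betaI.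
    by rewrite [f _](free_ext_gen _ b) eq_sym (negbTE ab) eqxx.
  rewrite -[(f \o phi) _]/(f (phi _)) [phi _](free_ext_gen _ m) /conjg invgK.
  rewrite !gmulfM fb homV !permM fa //.
  by apply: (canLR (permK _)); rewrite fa // permE /= inordK.
move=> phiu; have := perm_intertwine fphi i.
by rewrite /= phiu hom1 perm1 => -[/esym].
Qed.

Lemma verbal_nontrivial (A : choiceType) (a b : A) : a <> b -> ~ (forall G, V G) ->
  exists2 w, normal_set (verbal V A) w & w <> 1.
Proof.
move=> ab nV; have [u [Vu u1]] : exists u, identities V u /\ u <> 1.
  apply: contrapT => noid; apply: nV; apply: all_of_no_identities => u Vu.
  by apply: contrapT => u1; apply: noid; exists u.
have [phi phiu] := nat_embedding ab u1.
by exists (phi u) => // N [_]; apply; exists u, phi.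
Qed.

End Verbal.

(** * Subgroups of finite index *)

Section FiniteIndex.
Variables (A : choiceType) (H : set (free_group A)).
Hypothesis HH : is_subgroup H.
Local Notation F := (free_group A).

(** Inversion exchanges the right cosets used here with left cosets. *)
Lemma finite_indexP :
  finite_index H <-> exists X : seq F, forall x, coset_rep H x \in X.
Proof.
have [_ HM Hinv] := HH; split=> [finH|[X HX]].
  pose h (C : set F) := xget 1 [set y | C y^-1].
  have [X XE] : exists X : seq F,
      h @` range (fun x : F => [set x * s | s in H]) = [set` X].
    exact/finite_seqP/finite_image.
  exists X => x; suff : [set` X] (coset_rep H x) by [].
  rewrite -XE; exists [set x^-1 * s | s in H]; first by exists x^-1.
  rewrite /h /coset_rep; congr xget; apply/seteqP; split=> y /=.
    by move=> [s Hs /(congr1 (fun t => x * t))]; rewrite mulVKg => <-.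
  by move=> Hxy; exists (x * y^-1) => //; rewrite mulKg.
pose h p : set F := [set z | H (p * z)].
apply: (@sub_finite_set _ _ (h @` [set` X]));
  last exact/finite_image/finite_seq.
move=> _ [x _ <-]; exists (coset_rep H x^-1); first exact: HX.
have := coset_repP HH x^-1; set p := coset_rep _ _ => Hp.
apply/seteqP; split=> z /=.
  by move=> Hpz; exists (x^-1 * z);
    [have := HM _ _ Hp Hpz; rewrite mulgA mulgVK | rewrite mulVKg].
by move=> [s Hs <-]; have := HM _ _ (Hinv _ Hp) Hs; rewrite invgM !invgK -mulgA.
Qed.

(** Schreier's lemma: the generators are the elements [p a q^-1], where [p] is a
    coset representative, [a] a letter and [q] represents the coset of [p a],
    since reading a word multiplies such elements. The representative of [H] is
    added because it need not be 1. *)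
Lemma finite_index_finitely_generated : finite_set [set: A] ->
  finite_index H -> finitely_generated H.
Proof.
have [H1 HM Hinv] := HH.
move=> /finite_seqP[L LE] /finite_indexP[X HX].
pose gen p (l : A * bool) := p * letter_gen l * (coset_rep H (p * letter_gen l))^-1.
pose gs := coset_rep H 1 :: [seq gen p (a, false) | p <- X, a <- L].
exists gs; set K := generated _.
have [K1 KM KV] : is_subgroup K by exact: generated_subgroup.
apply/seteqP; split; last first.
  apply: generated_sub => // x /=; rewrite inE => /orP[/eqP->|].
    by have := Hinv _ (coset_repP HH 1); rewrite mul1g invgK.
  by move=> /allpairsP[[p a] [_ _ ->]]; exact: coset_repP.
have Kgen x l : K (gen (coset_rep H x) l).
  have Kpos y a : K (gen (coset_rep H y) (a, false)).
    apply: sub_generated; rewrite /= inE; apply/orP; right.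
    apply/allpairsP; exists (coset_rep H y, a); split; rewrite //=.
    by have : [set` L] a by rewrite -LE.
  case: l => a [] //; have := KV _ (Kpos (x * (free_gen a)^-1) a).
  rewrite /gen !(coset_rep_mul HH) !letter_genE mulgVK.
  by rewrite !invgM invgK mulgA.
have Kword w x : K (coset_rep H x * word_prod w * (coset_rep H (x * word_prod w))^-1).
  elim: w x => [|l w IHw] x; first by rewrite /= !mulg1 mulgV.
  have := KM _ _ (Kgen x l) (IHw (coset_rep H x * letter_gen l)).
  rewrite /gen coset_rep_mul // !mulgA mulgVK /=.
  by rewrite -!mulgA [coset_rep H (coset_rep H x * _)]coset_rep_mul // !mulgA.
move=> x Hx; have := Kword (word x) 1; rewrite word_prodK mul1g.
rewrite (proj2 (coset_rep_mem HH x) Hx); set q := coset_rep H 1 => Kx.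
have Kq : K q by apply: sub_generated; rewrite /= mem_head.
have := KM _ _ (KM _ _ (KV _ Kq) Kx) Kq.
by rewrite !mulgA mulVg mul1g mulgVK.
Qed.

End FiniteIndex.

(** * The closure of a finitely generated subgroup *)

Section Closure.
Variables (V : group_class) (HV : is_variety V) (A : choiceType).
Variable ws : seq (free_group A).
Let H := generated [set` ws].
Let Cl := pro_closure (finite_trace V) H.

Let HCl : is_subgroup Cl.
Proof. exact/pro_closure_subgroup/generated_subgroup. Qed.

Lemma verbal_sub_closure : normal_set (verbal V A) `<=` Cl.
Proof.
move=> x Vx; apply: (verbal_sub_pro_closure HV); exists 1, x.
by split; rewrite ?mul1g //; case: (generated_subgroup [set` ws]).
Qed.

Lemma closure_finitely_generated_all : (forall G, V G) -> finitely_generated Cl.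
Proof.
move=> Vall; exists ws; apply/seteqP; split; last exact: sub_pro_closure.
exact: (verbal_trivial_closed HV (verbal_trivial_of_all Vall)).
Qed.

Lemma closure_infinite_rank : infinite_set [set: A] ->
  finitely_generated Cl -> forall G, V G.
Proof.
move=> infA [gs ClE]; apply: contrapT => nV.
have [a [b ab]] : exists a b : A, a <> b.
  apply: contrapT => A1; apply: infA;
    have [[a _]|noA] := pselect (exists a : A, True).
    rewrite (_ : [set: A] = [set a]); first exact: finite_set1.
    by apply/seteqP; split=> // b _; apply: contrapT => /= ba; apply: A1;
      exists b, a.
  rewrite (_ : [set: A] = set0); first exact: finite_set0.
  by apply/seteqP; split=> // b _; case: noA; exists b.
have nontriv := verbal_nontrivial HV ab nV.
pose L := flatten [seq map fst (word g) | g <- gs].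
apply: infA; apply: (@sub_finite_set _ _ [set` L]); last exact: finite_seq.
move=> c _;
  apply: (normal_all_letters (normalP (verbal V A)) nontriv (ws := gs)).
  by rewrite -ClE; exact: verbal_sub_closure.
move=> g g_gs l lg /=; apply/flattenP; exists (map fst (word g));
  last exact: map_f.
exact: (map_f (fun g : free_group A => map fst (word g))).
Qed.

Lemma closure_finite_rank : ~ ((exists a : A, [set: A] = [set a]) /\ H = [set 1]) ->
  finitely_generated Cl -> (forall G, V G) \/ finite_index Cl.
Proof.
move=> nexc [gs ClE]; have [[a [b ab]]|A1] := pselect (exists a b : A, a <> b).
  have [|nV] := pselect (forall G, V G); first by left.
  right; apply/(finite_indexP HCl); exists (prefix_reps Cl gs).
  rewrite ClE; apply: full_prefix_reps (verbal_nontrivial HV ab nV) _.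
  - by case: (normalP (verbal V A)).
  - by left; exact: normalP.
  - by rewrite -ClE; exact: verbal_sub_closure.
have {}A1 a b : a = b :> A by apply: contrapT => ab; apply: A1; exists a, b.
right; apply/(finite_indexP HCl).
have [[w Hw w1]|H1] := pselect (exists2 w, H w & w <> 1).
  exists (prefix_reps Cl gs); rewrite ClE.
  apply: (full_prefix_reps (S := H));
    [exact: generated_subgroup | by right | |].
    by exists w.
  by rewrite -ClE; exact: sub_pro_closure.
have [[a _]|noA] := pselect (exists a : A, True).
  case: nexc; split; first by exists a; apply/seteqP; split=> // b _; exact: A1.
  apply/seteqP; split=> w /=; first by move=> Hw; apply: contrapT => w1;
    apply: H1; exists w.
  by move=> ->; case: (generated_subgroup [set` ws]).
exists [:: coset_rep Cl 1] => x; rewrite inE; apply/eqP; congr coset_rep.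
rewrite -[x]word_prodK; case: (word x) => [|[a b] w]; first by [].
by case: noA; exists a.
Qed.

End Closure.

(** * Recursive functions *)

Section Recursive.
Local Open Scope nat_scope.

(** The arguments of a recursive function form an environment, a sequence of
    which the first [k] entries are read; in the body of an operator that binds
    a variable the environment is extended at the front. *)
Definition recursive k (F : seq nat -> nat) : Prop :=
  total_recursive (fun x : k.-tuple nat => F x).

Lemma recursive_ext k F G : (forall s, size s = k -> F s = G s) ->
  recursive k G -> recursive k F.
Proof.
move=> FG; rewrite /recursive; congr (total_recursive _).
by apply/funext => x; rewrite FG ?size_tuple.
Qed.

Lemma recursive_var k i : i < k -> recursive k (fun s => nth 0 s i).
Proof.
move=> ik; rewrite /recursive.
have -> : (fun x : k.-tuple nat => nth 0 x i) = fun x => tnth x (Ordinal ik).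
  by apply/funext => x; rewrite (tnth_nth 0).
exact: Rec_proj.
Qed.

Lemma recursive_comp k m (fs : 'I_m -> seq nat -> nat) G :
  (forall i, recursive k (fs i)) -> recursive m G ->
  recursive k (fun s => G [seq fs i s | i <- enum 'I_m]).
Proof.
move=> rfs rG; have := Rec_comp rG rfs; rewrite /recursive.
congr (total_recursive _); apply/funext => x /=; congr G.
Qed.

Lemma recursive_comp_nth k (fs : seq (seq nat -> nat)) G :
  (forall i, i < size fs -> recursive k (nth (fun=> 0) fs i)) ->
  recursive (size fs) G -> recursive k (fun s => G [seq f s | f <- fs]).
Proof.
move=> rfs rG.
apply: recursive_ext (recursive_comp (fs := fun i => nth (fun=> 0) fs i) _ rG).
  move=> s _; congr G; apply: (@eq_from_nth _ 0).
    by rewrite !size_map -enumT size_enum_ord.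
  move=> i; rewrite size_map => ifs.
  rewrite (nth_map (fun=> 0)) // (nth_map (Ordinal ifs)) ?size_enum_ord //.
  by rewrite (nth_enum_ord (Ordinal ifs) ifs).
by move=> i; apply: rfs.
Qed.

Lemma recursive_comp1 k a G : recursive 1 G -> recursive k a ->
  recursive k (fun s => G [:: a s]).
Proof. by move=> rG ra; apply: (@recursive_comp_nth k [:: a]) => // -[]. Qed.

Lemma recursive_succ k F : recursive k F -> recursive k (fun s => (F s).+1).
Proof.
apply: (@recursive_comp1 _ _ (fun s => (head 0 s).+1)); rewrite /recursive.
have -> : (fun x : 1.-tuple nat => (head 0 x).+1) = fun x => (thead x).+1.
  by apply/funext => x; rewrite {1}(tuple_eta x).
exact: Rec_succ.
Qed.

Lemma recursive_const k c : recursive k (fun=> c).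
Proof. by elim: c => [|c IHc]; [exact: Rec_zero | exact: recursive_succ]. Qed.

(** In de Bruijn terms, weakening. *)
Lemma recursive_weaken k F : recursive k F ->
  recursive k.+1 (fun s => F (behead s)).
Proof.
move=> rF; set fs := mkseq (fun i s => nth 0 s i.+1) k.
have sfs : size fs = k by rewrite size_mkseq.
apply: recursive_ext (@recursive_comp_nth k.+1 fs F _ _).
- case=> // x s [sk]; congr F; apply: (@eq_from_nth _ 0) => /=.
    by rewrite size_map size_mkseq.
  move=> i; rewrite sk => ik; rewrite (nth_map (fun=> 0)) ?size_mkseq //.
  by rewrite nth_mkseq.
- move=> i; rewrite sfs => ik; rewrite nth_mkseq //.
  exact: recursive_var.
- by rewrite sfs.
Qed.

(** In de Bruijn terms, substitution for the innermost variable. *)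
Lemma recursive_subst k F B : recursive k.+1 F -> recursive k B ->
  recursive k (fun s => F (B s :: s)).
Proof.
move=> rF rB; set fs := B :: mkseq (fun i s => nth 0 s i) k.
have sfs : size fs = k.+1 by rewrite /= size_mkseq.
apply: recursive_ext (@recursive_comp_nth k fs F _ _).
- move=> s sk; congr (F (_ :: _)); apply: (@eq_from_nth _ 0) => /=.
    by rewrite size_map size_mkseq.
  move=> i; rewrite sk => ik; rewrite (nth_map (fun=> 0)) ?size_mkseq //.
  by rewrite nth_mkseq.
- move=> [|i]; rewrite sfs //= ltnS => ik; rewrite nth_mkseq //.
  exact: recursive_var.
- by rewrite sfs.
Qed.

(** Weakening below the innermost variable. *)
Lemma recursive_insert n k F : recursive k.+1 F ->
  recursive (n + k).+1 (fun s => F (nth 0 s 0 :: drop n.+1 s)).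
Proof.
move=> rF;
  set fs := (fun s => nth 0 s 0) :: mkseq (fun i s => nth 0 s (n.+1 + i)) k.
have sfs : size fs = k.+1 by rewrite /= size_mkseq.
apply: recursive_ext (@recursive_comp_nth (n + k).+1 fs F _ _).
- move=> s sk; congr (F (_ :: _)); apply: (@eq_from_nth _ 0).
    by rewrite size_map size_mkseq size_drop sk subSS addKn.
  move=> i; rewrite size_drop sk subSS addKn => ik; rewrite nth_drop.
  by rewrite (nth_map (fun=> 0)) ?size_mkseq // nth_mkseq.
- move=> [|i]; rewrite sfs //= ltnS => ik; first exact: recursive_var.
  by rewrite nth_mkseq //; apply: recursive_var; rewrite addSn ltnS ltn_add2l.
- by rewrite sfs.
Qed.

Lemma recursive_iter k F (G : nat -> nat -> seq nat -> nat) B :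
  recursive k F ->
  recursive k.+2 (fun s => G (nth 0 s 0) (nth 0 s 1) (behead (behead s))) ->
  recursive k B ->
  recursive k (fun s => nat_rect (fun=> nat) (F s) (fun n r => G n r s) (B s)).
Proof.
move=> rF rG; apply: (@recursive_subst k (fun s =>
  nat_rect (fun=> nat) (F (behead s)) (fun n r => G n r (behead s)) (nth 0 s 0))).
by apply: Rec_prim rF rG _ _.
Qed.

Lemma recursive_add k F G : recursive k F -> recursive k G ->
  recursive k (fun s => F s + G s).
Proof.
move=> rF rG;
  apply: recursive_ext (recursive_iter (G := fun _ r _ => r.+1) rF _ rG).
  by move=> s _; elim: (G s) => [|n IHn] /=; rewrite ?addn0 // addnS IHn.
exact/recursive_succ/recursive_var.
Qed.

Lemma recursive_mul k F G : recursive k F -> recursive k G ->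
  recursive k (fun s => F s * G s).
Proof.
move=> rF rG.
apply: recursive_ext (recursive_iter (G := fun _ r s => r + F s)
  (recursive_const k 0) _ rG).
  by move=> s _; elim: (G s) => [|n IHn] /=; rewrite ?muln0 // mulnSr IHn.
apply: recursive_add; first exact: recursive_var.
exact: (recursive_weaken (recursive_weaken rF)).
Qed.

Lemma recursive_exp k F G : recursive k F -> recursive k G ->
  recursive k (fun s => F s ^ G s).
Proof.
move=> rF rG.
apply: recursive_ext (recursive_iter (G := fun _ r s => r * F s)
  (recursive_const k 1) _ rG).
  by move=> s _; elim: (G s) => [|n IHn] /=; rewrite ?expn0 // expnSr IHn.
apply: recursive_mul; first exact: recursive_var.
exact: (recursive_weaken (recursive_weaken rF)).
Qed.

Lemma recursive_sub k F G : recursive k F -> recursive k G ->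
  recursive k (fun s => F s - G s).
Proof.
move=> rF rG.
have rpred m : recursive m.+1 (fun s => (nth 0 s 0).-1).
  apply: recursive_ext (recursive_iter (G := fun n _ _ => n)
    (recursive_const _ 0) _ (recursive_var (ltn0Sn m))).
    by move=> s _; case: (nth 0 s 0).
  exact: recursive_var.
apply: recursive_ext (recursive_iter (G := fun _ r _ => r.-1) rF _ rG).
  by move=> s _; elim: (G s) => [|n IHn] /=; rewrite ?subn0 // subnS IHn.
apply: (@recursive_comp1 _ _ (fun s => (nth 0 s 0).-1)) => //.
exact: recursive_var.
Qed.

(** Predicates are recursive through the values 0 and 1 of [bool]. *)
Lemma recursive_leq k F G : recursive k F -> recursive k G ->
  recursive k (fun s => F s <= G s).
Proof.
move=> rF rG.
apply: recursive_ext (recursive_sub (recursive_const k 1) (recursive_sub rF rG)).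
by move=> s _; rewrite /leq; case: (F s - G s).
Qed.

Lemma recursive_and k (P Q : seq nat -> bool) : recursive k P -> recursive k Q ->
  recursive k (fun s => P s && Q s).
Proof.
move=> rP rQ; apply: recursive_ext (recursive_mul rP rQ) => s _.
by case: (P s); case: (Q s).
Qed.

Lemma recursive_not k (P : seq nat -> bool) : recursive k P ->
  recursive k (fun s => ~~ P s).
Proof.
move=> rP; apply: recursive_ext (recursive_sub (recursive_const k 1) rP) => s _.
by case: (P s).
Qed.

Lemma recursive_imp k (P Q : seq nat -> bool) : recursive k P -> recursive k Q ->
  recursive k (fun s => P s ==> Q s).
Proof.
move=> rP rQ; have := recursive_not (recursive_and rP (recursive_not rQ)).
by apply: recursive_ext => s _; case: (P s); case: (Q s).
Qed.

Lemma recursive_eq k F G : recursive k F -> recursive k G ->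
  recursive k (fun s => F s == G s).
Proof.
move=> rF rG.
have := recursive_and (recursive_leq rF rG) (recursive_leq rG rF).
by apply: recursive_ext => s _; rewrite eqn_leq.
Qed.

Lemma recursive_if k (P : seq nat -> bool) F G : recursive k P ->
  recursive k F -> recursive k G -> recursive k (fun s => if P s then F s else G s).
Proof.
move=> rP rF rG; have := recursive_add (recursive_mul rP rF)
  (recursive_mul (recursive_not rP) rG).
by apply: recursive_ext => s _; case: (P s); rewrite ?mul1n ?mul0n ?addn0.
Qed.

Lemma recursive_sum k (F : nat -> seq nat -> nat) B :
  recursive k.+1 (fun s => F (nth 0 s 0) (behead s)) -> recursive k B ->
  recursive k (fun s => \sum_(i < B s) F i s).
Proof.
move=> rF rB; have := recursive_iter (G := fun n r s => r + F n s)
  (recursive_const k 0) _ rB.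
move=> /(_ _)/recursive_ext; apply.
  by move=> s _; elim: (B s) => [|n IHn] /=;
    rewrite ?big_ord0 // big_ord_recr -IHn.
apply: recursive_add; first exact: recursive_var.
apply: recursive_ext (recursive_insert 1 rF) => -[|a [|b s]] //= _.
by rewrite drop0.
Qed.

Lemma recursive_all k (P : nat -> seq nat -> bool) B :
  recursive k.+1 (fun s => P (nth 0 s 0) (behead s)) -> recursive k B ->
  recursive k (fun s => all (P^~ s) (iota 0 (B s))).
Proof.
move=> rP rB.
have := recursive_eq (recursive_sum (F := fun i s => ~~ P i s)
  (recursive_not rP) rB) (recursive_const k 0).
apply: recursive_ext => s _; congr nat_of_bool.
rewrite sum_nat_eq0; apply/allP/forallP => [allP i|allP i].
  by rewrite eqb0 negbK allP // mem_iota /=.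
by rewrite mem_iota => iB; have := allP (Ordinal iB); rewrite eqb0 negbK.
Qed.

Lemma recursive_has k (P : nat -> seq nat -> bool) B :
  recursive k.+1 (fun s => P (nth 0 s 0) (behead s)) -> recursive k B ->
  recursive k (fun s => has (P^~ s) (iota 0 (B s))).
Proof.
move=> rP rB; have := recursive_not (recursive_all
  (P := fun i s => ~~ P i s) (recursive_not rP) rB).
by apply: recursive_ext => s _; rewrite -has_predC /predC; congr nat_of_bool;
  apply: eq_has => i /=; rewrite negbK.
Qed.

(** The range is a constant of the algorithm, so it may be any finite set. *)
Lemma recursive_all_seq k (L : seq nat) (P : nat -> seq nat -> bool) :
  (forall j, recursive k (P j)) -> recursive k (fun s => all (P^~ s) L).
Proof.
move=> rP; elim: L => [|j L IHL] /=; first exact: (recursive_const k 1).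
by apply: recursive_and.
Qed.

Lemma recursive_divn k F G : recursive k F -> recursive k G ->
  recursive k (fun s => F s %/ G s).
Proof.
move=> rF rG.
have := recursive_if (recursive_eq rG (recursive_const k 0)) (recursive_const k 0)
  (recursive_sum (F := fun i s => i.+1 * G s <= F s) _ rF).
move=> /(_ _)/recursive_ext; apply.
  move=> s _; case: (posnP (G s)) => [->|G0]; first by rewrite divn0.
  rewrite -(eq_bigr _ (fun i _ => congr1 nat_of_bool (leq_divRL _ _ G0))).
  have le_div : F s %/ G s <= F s by exact: leq_div.
  rewrite -[RHS]/(\sum_(i < F s) (i < F s %/ G s)).
  rewrite -[LHS](minn_idPr le_div).
  elim: (F s) {le_div} (F s %/ G s) => [|m IHm] q.
    by rewrite min0n big_ord0.
  by rewrite big_ord_recr /= -(IHm q); lia.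
apply: recursive_leq; last exact: recursive_weaken.
apply: recursive_mul; last exact: recursive_weaken.
exact/recursive_succ/recursive_var.
Qed.

Lemma recursive_modn k F G : recursive k F -> recursive k G ->
  recursive k (fun s => F s %% G s).
Proof.
move=> rF rG.
have := recursive_sub rF (recursive_mul (recursive_divn rF rG) rG).
by apply: recursive_ext => s _; rewrite {2}(divn_eq (F s) (G s)) addKn.
Qed.

Lemma recursive_log2 k F : recursive k F -> recursive k (fun s => logn 2 (F s)).
Proof.
move=> rF.
have := recursive_if (recursive_eq rF (recursive_const k 0)) (recursive_const k 0)
  (recursive_sum (F := fun i s => F s %% 2 ^ i.+1 == 0) _ rF).
move=> /(_ _)/recursive_ext; apply.
  move=> s _; case: eqP => [->|/eqP F0]; first by rewrite logn0.
  rewrite logn_count_dvd // big_add1 /= big_mkord.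
  case: (F s) F0 => // n _; rewrite big_ord_recr /=.
  rewrite [X in _ + X](_ : _ = 0) ?addn0 //.
  by rewrite modn_small // ltn_expl.
apply: recursive_eq; last exact: recursive_const.
apply: recursive_modn; first exact: recursive_weaken.
apply: recursive_exp; first exact: recursive_const.
exact/recursive_succ/recursive_var.
Qed.

End Recursive.

(** * A recursive test on coded permutation actions *)

Ltac recursive_variable :=
  first [ apply: recursive_var; reflexivity
        | eapply recursive_ext;
            [ move=> ? _; rewrite !nth_behead; reflexivity
            | apply: recursive_var; reflexivity ] ].

(** The rules are selected by syntax, since a numeral or a power could unify
    with the wrong one. *)
Ltac recursive_step :=
  lazymatch goal with
  | |- recursive _ (fun s => nth 0 _ _) => recursive_variable
  | |- recursive _ (fun s => S (@?F s)) => apply: recursive_succ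
  | |- recursive _ (fun s => addn (@?F s) (@?G s)) => apply: recursive_add
  | |- recursive _ (fun s => muln (@?F s) (@?G s)) => apply: recursive_mul
  | |- recursive _ (fun s => expn (@?F s) (@?G s)) => apply: recursive_exp
  | |- recursive _ (fun s => divn (@?F s) (@?G s)) => apply: recursive_divn
  | |- recursive _ (fun s => modn (@?F s) (@?G s)) => apply: recursive_modn
  | |- recursive _ (fun s => logn 2 (@?F s)) => apply: recursive_log2
  | |- recursive _ (fun s => nat_of_bool (@?F s && @?G s)) =>
      apply: recursive_and
  | |- recursive _ (fun s => nat_of_bool (@?F s ==> @?G s)) =>
      apply: recursive_imp
  | |- recursive _ (fun s => nat_of_bool (~~ @?F s)) => apply: recursive_not
  | |- recursive _ (fun s => nat_of_bool (@?F s == @?G s)) =>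
      apply: recursive_eq
  | |- recursive _ (fun s => nat_of_bool (all _ (iota 0 _))) =>
      apply: recursive_all
  | |- recursive _ (fun s => nat_of_bool (all _ _)) =>
      apply: recursive_all_seq => ?
  | |- recursive _ (fun s => nat_of_bool (has _ (iota 0 _))) =>
      apply: recursive_has
  | |- recursive _ (fun s => ?c) => apply: recursive_const
  end.

Section CodedData.
Local Open Scope nat_scope.

(** A function with values below [b] is coded by the base [b] numeral whose
    digits are its values. *)
Definition digit b c i := c %/ b ^ i %% b.

Lemma ltn_digit b c i : 0 < b -> digit b c i < b.
Proof. by move=> b0; rewrite ltn_pmod. Qed.

Lemma digit_code b n (h : nat -> nat) : (forall i, i < n -> h i < b) ->
  exists2 c, c < b ^ n & forall i, i < n -> digit b c i = h i.
Proof.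
elim: n h => [|n IHn] h hb; first by exists 0.
have [c cb ch] := IHn (fun i => h i.+1) (fun i ilt => hb i.+1 ilt).
have b0 : 0 < b by apply: leq_ltn_trans (hb 0 _).
exists (c * b + h 0).
  have := hb 0 isT; rewrite expnS; nia.
case=> [|i] ilt; rewrite /digit.
  by rewrite divn1 modnMDl modn_small ?hb.
by rewrite expnS divnMA divnMDl // [h 0 %/ b]divn_small ?hb // addn0; apply: ch.
Qed.

Lemma recursive_digit k B C F : recursive k B -> recursive k C ->
  recursive k F -> recursive k (fun s => digit (B s) (C s) (F s)).
Proof.
by move=> rB rC rF; rewrite /digit; repeat (assumption || recursive_step).
Qed.

(** On the code of a sequence, the tail is computed by dividing out the head,
    which is the 2-adic valuation. *)
Definition code_tail c := c %/ 2 ^ (logn 2 c).+1.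

Definition code_drop i c := iter i code_tail c.

Lemma log2_code_cons n s : logn 2 (CodeSeq.code (n :: s)) = n.
Proof.
by rewrite /= lognM ?expn_gt0 // pfactorK // logn_coprime ?addn0 //
  coprime2n /= odd_double.
Qed.

Lemma code_tail_cons n s : code_tail (CodeSeq.code (n :: s)) = CodeSeq.code s.
Proof.
rewrite /code_tail log2_code_cons /= expnSr divnMA.
by rewrite mulKn ?expn_gt0 // -muln2 -addn1 divnMDl ?addn0.
Qed.

Lemma code_drop_code i s : code_drop i (CodeSeq.code s) = CodeSeq.code (drop i s).
Proof.
elim: i s => [|i IHi] s; first by rewrite drop0.
case: s => [|n s]; rewrite /code_drop iterSr.
  by rewrite [code_tail _]div0n; apply: (IHi [::]).
by rewrite code_tail_cons; apply: IHi.
Qed.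

Lemma code_eq0 s : (CodeSeq.code s == 0) = (s == [::]).
Proof. by case: s => //= n s; rewrite muln_eq0 expn_eq0. Qed.

Lemma leq_size_code s : sumn s + size s <= CodeSeq.code s.
Proof.
elim: s => //= n s IHs; have := ltn_expl n (ltnSn 1).
by move: (2 ^ n) => m nm; rewrite -muln2; nia.
Qed.

Lemma recursive_code_drop k F G : recursive k F -> recursive k G ->
  recursive k (fun s => code_drop (F s) (G s)).
Proof.
move=> rF rG.
apply: recursive_ext (recursive_iter (G := fun _ r _ => code_tail r) rG _ rF).
  by move=> s _; elim: (F s) => [|n IHn] //=; rewrite -IHn.
by rewrite /code_tail; repeat recursive_step.
Qed.

Lemma recursive_code_mkseq k (F : nat -> seq nat -> nat) B :
  recursive k.+1 (fun s => F (nth 0 s 0) (behead s)) -> recursive k B ->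
  recursive k (fun s => CodeSeq.code (mkseq (F^~ s) (B s))).
Proof.
move=> rF rB.
(* The entries are put in front one by one, starting from the last. *)
apply: recursive_ext (recursive_iter
  (G := fun n r s => 2 ^ F (B s - n.+1) s * (r * 2).+1) (recursive_const k 0) _ rB).
  move=> s _; set acc := nat_rect _ _ _.
  suff accE n : n <= B s ->
      acc n = CodeSeq.code [seq F i s | i <- iota (B s - n) n].
    by rewrite accE // subnn.
  elim: n => // n IHn nB; rewrite /= IHn ?(ltnW nB) //.
  by rewrite muln2; congr (_ * (CodeSeq.code (map _ (iota _ _))).*2.+1); lia.
apply: recursive_mul; last by repeat recursive_step.
apply: recursive_exp; first exact: recursive_const.
have rI : recursive k.+2 (fun s => B (behead (behead s)) - (nth 0 s 0).+1).
  apply: recursive_sub; first exact: (recursive_weaken (recursive_weaken rB)).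
  exact/recursive_succ/recursive_var.
apply: recursive_ext (recursive_subst (recursive_insert 2 rF) rI).
by case=> [|a [|b s]] //= _; rewrite drop0.
Qed.



(** The numeral [c] codes an action of the letters on the states below [n]: the
    letter [l] sends the state [i] to [digit n c (l * n + i)]. Reading a word of
    code [y] takes at most [y] steps, and a step on an exhausted code is idle. *)
Definition run n c y := nat_rect (fun=> nat) 0
  (fun i r => if code_drop i y == 0 then r
              else digit n c (logn 2 (code_drop i y) * n + r)) y.

Lemma run_code n c w : run n c (CodeSeq.code w) =
  foldl (fun i l => digit n c (l * n + i)) 0 w.
Proof.
rewrite /run; set y := CodeSeq.code w.
suff runE m : nat_rect (fun=> nat) 0 (fun i r => if code_drop i y == 0 then r
              else digit n c (logn 2 (code_drop i y) * n + r)) m =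
    foldl (fun i l => digit n c (l * n + i)) 0 (take m w).
  by rewrite runE take_oversize // (leq_trans _ (leq_size_code w)) ?leq_addl.
elim: m => [|m IHm] /=; first by rewrite take0.
rewrite code_drop_code code_eq0 -size_eq0 size_drop subn_eq0 IHm.
case: leqP => [mw|mw]; first by rewrite !take_oversize // ltnW.
rewrite (take_nth 0 mw) foldl_rcons (drop_nth 0 mw).
by rewrite log2_code_cons.
Qed.

Lemma recursive_run k N C Y : recursive k N -> recursive k C -> recursive k Y ->
  recursive k (fun s => run (N s) (C s) (Y s)).
Proof.
move=> rN rC rY; apply: recursive_iter => //; first exact: recursive_const.
have rN2 := recursive_weaken (recursive_weaken rN).
have rY2 := recursive_weaken (recursive_weaken rY).
have rC2 := recursive_weaken (recursive_weaken rC).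
have rD := recursive_code_drop (recursive_var (ltn0Sn k.+1)) rY2.
apply: recursive_if; first by apply: recursive_eq; last exact: recursive_const.
  exact: recursive_var.
apply: recursive_digit => //; apply: recursive_add; last exact: recursive_var.
by apply: recursive_mul => //; apply: recursive_log2.
Qed.

Definition group_code n d u :=
  all (fun i => [&& digit n d (u * n + i) == i, digit n d (i * n + u) == i,
    has (fun j => (digit n d (i * n + j) == u) && (digit n d (j * n + i) == u))
      (iota 0 n) &
    all (fun j => all (fun l => digit n d (digit n d (i * n + j) * n + l) ==
      digit n d (i * n + digit n d (j * n + l))) (iota 0 n)) (iota 0 n)])
  (iota 0 n).

Definition table_code n d :=
  CodeSeq.code (mkseq (fun i =>
    CodeSeq.code (mkseq (fun j => digit n d (i * n + j)) n)) n).

(** In the test, [L] lists the numbers of the generators, [M] exceeds them, and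
    the letters [j.*2] and [j.*2.+1] are the generator with number [j] and its
    inverse; the oracle recognizes the tables of the finite groups of the
    variety. *)
Section Test.
Variables (oracle : nat -> nat) (L : seq nat) (M : nat).
Hypothesis rec_oracle : recursive 1 (fun s => oracle (nth 0 s 0)).

Let recursive_oracle k F : recursive k F -> recursive k (fun s => oracle (F s)).
Proof. exact: recursive_comp1 rec_oracle. Qed.

Definition action_code n c :=
  all (fun j => all (fun i =>
      (digit n c (j.*2.+1 * n + digit n c (j.*2 * n + i)) == i) &&
      (digit n c (j.*2 * n + digit n c (j.*2.+1 * n + i)) == i)) (iota 0 n)) L.

Definition fixes_code n c x :=
  all (fun i => (code_drop i x != 0) ==>
         (run n c (logn 2 (code_drop i x)) == 0)) (iota 0 x).

(** The search is for a group of order [k] with multiplication table [d] and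
    identity [u], the images [g] of the generators, and a map [a] from the group
    to the states which sends the identity to 0 and commutes with the generators.
    Then the state reached from 0 by a word depends on the image of the word in
    the group only, so that the stabilizer of 0 is open. The state [p] is out of
    reach. A group acting faithfully on the [n] states has order at most [n ^ n],
    which bounds the search. *)
Definition covered n c :=
  has (fun k => has (fun d => has (fun g => has (fun a => has (fun u => has (fun p =>
    [&& group_code k d u, oracle (table_code k d) == 1, digit n a u == 0,
      all (fun j => all (fun i => digit n a (digit k d (i * k + digit k g j)) ==
            digit n c (j.*2 * n + digit n a i)) (iota 0 k)) L &
      all (fun i => digit n a i != p) (iota 0 k)])
  (iota 0 n)) (iota 0 k)) (iota 0 (n ^ k))) (iota 0 (k ^ M)))
  (iota 0 (k ^ (k * k)))) (iota 0 (n ^ n).+1).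

(** The code of a list of words exceeds their total length, so [x.+2] exceeds the
    number of vertices of the Stallings graph of the subgroup. *)
Definition closedness_test x :=
  all (fun c => action_code x.+2 c && fixes_code x.+2 c x ==> covered x.+2 c)
    (iota 0 (x.+2 ^ (M.*2 * x.+2))).

Lemma recursive_closedness_test : recursive 1 (fun s => closedness_test (nth 0 s 0)).
Proof.
rewrite /closedness_test /action_code /fixes_code /covered /group_code /table_code.
repeat first [recursive_step |
lazymatch goal with
  | |- recursive _ (fun s => digit _ _ _) => apply: recursive_digit
  | |- recursive _ (fun s => run _ _ _) => apply: recursive_run
  | |- recursive _ (fun s => code_drop _ _) => apply: recursive_code_drop
  | |- recursive _ (fun s => CodeSeq.code _) => apply: recursive_code_mkseq
  | |- recursive _ (fun s => oracle _) => apply: recursive_oracle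
  end].
Qed.
End Test.
End CodedData.

(** * Deciding closedness *)

Section Coding.
Variables (A : choiceType) (L : seq A) (e : A -> nat).
Hypotheses (LA : forall a, a \in L) (e_inj : injective e).
Local Notation F := (free_group A).
Local Notation codes := (map (code_letter e)).

Definition letter_bound := (sumn (map e L)).+1.

Lemma code_letter_bound l : (code_letter e l < letter_bound.*2)%N.
Proof.
case: l => a b; rewrite /code_letter /letter_bound /=.
suff : (e a <= sumn (map e L))%N by case: b; lia.
have := LA a; elim: L => //= c K IHK; rewrite inE => /orP[/eqP->|/IHK]; lia.
Qed.

(** A number that codes no letter is sent to 1, so that it acts trivially. *)
Definition decode_letter (m : nat) : F :=
  let g := nth 1 (map (@free_gen A) L) (index m./2 (map e L)) in
  if odd m then g^-1 else g.

Lemma code_letterK l : decode_letter (code_letter e l) = letter_gen l.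
Proof.
case: l => a b; rewrite /decode_letter /code_letter letter_genE /=.
have -> : ((e a).*2 + b)./2 = e a by case: b; lia.
have -> : odd ((e a).*2 + b) = b by rewrite oddD odd_double; case: b.
by rewrite index_map // (nth_map a) ?index_mem // nth_index.
Qed.

Definition codes_action n c (r : {multiplicative F -> {perm 'I_n}}) :=
  forall l (i : 'I_n),
    r (letter_gen l) i = digit n c (code_letter e l * n + i) :> nat.

Lemma codes_action_word n c r (i : 'I_n) w : codes_action c r ->
  r (word_prod w) i =
  foldl (fun i l => digit n c (l * n + i)) i (codes w) :> nat.
Proof.
move=> rc; elim: w i => [|l w IHw] i /=; first by rewrite hom1 perm1.
by rewrite gmulfM permM IHw rc.
Qed.

Lemma action_of_code n c : (0 < n)%N -> action_code (map e L) n c ->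
  exists r : {multiplicative F -> {perm 'I_n}}, codes_action c r.
Proof.
move=> n0 /allP act.
pose sg (m : nat) (i : 'I_n) := Ordinal (ltn_digit c (m * n + i) n0).
have {}act a i : sg (e a).*2.+1 (sg (e a).*2 i) = i /\
    sg (e a).*2 (sg (e a).*2.+1 i) = i.
  have /act/allP : e a \in map e L by exact: map_f.
  move=> /(_ i); rewrite mem_iota => /(_ (ltn_ord i))/andP[/eqP ? /eqP ?].
  by split; apply: val_inj.
have inj a : injective (sg (e a).*2) by apply: can_inj (fun i => (act a i).1).
pose r : {multiplicative F -> {perm 'I_n}} := free_ext (fun a => perm (@inj a)).
exists r => -[a b] i; rewrite letter_genE.
have ra : r (free_gen a) = perm (@inj a) by exact: free_ext_gen.
case: b; last by rewrite ra permE /code_letter /= addn0.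
have -> : r (free_gen a)^-1 i = sg (e a).*2.+1 i.
  by rewrite homV ra; apply: (canLR (permK _)); rewrite permE (act a i).2.
by rewrite /code_letter addn1.
Qed.

Lemma code_of_action n (r : {multiplicative F -> {perm 'I_n}}) :
  exists c, [/\ (c < n ^ (letter_bound.*2 * n))%N, action_code (map e L) n c &
    codes_action c r].
Proof.
case: n r => [|n] r.
  exists 0%N; split=> [||l []//]; first by rewrite muln0.
  by apply/allP => j _; apply/allP.
pose h m := if (insub (m %% n.+1)%N : option 'I_n.+1) is Some i then
  val (r (decode_letter (m %/ n.+1)) i) else 0%N.
have [m _|c cb ch] := @digit_code n.+1 (letter_bound.*2 * n.+1) h.
  by rewrite /h; case: insubP => // i _ _; exact: ltn_ord.
have rc : codes_action c r.
  move=> l i; rewrite ch; last by have := code_letter_bound l;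
    have := ltn_ord i; nia.
  rewrite /h divnMDl // modnMDl divn_small ?modn_small ?ltn_ord // addn0.
  by rewrite valK code_letterK.
exists c; split=> //; apply/allP => _ /mapP[a _ ->]; apply/allP => i.
rewrite mem_iota /= => ilt.
have := rc (a, true); have := rc (a, false);
  rewrite /code_letter /= addn0 addn1.
move=> r0 r1; rewrite -[i]/(val (Ordinal ilt)) -r0 -r1 -r1 -r0.
by rewrite -!permM -!gmulfM !letter_genE /= mulgV mulVg hom1 perm1 !eqxx.
Qed.

Lemma drop_codes i ws : code_drop i (code_words e ws) =
  CodeSeq.code [seq CodeSeq.code (codes (word w)) | w <- drop i ws].
Proof. by rewrite /code_words /code_seq2 code_drop_code -!map_drop -map_comp. Qed.

Lemma fixes_codeP n c r (i0 : 'I_n) ws : codes_action c r -> i0 = 0%N :> nat ->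
  (fixes_code n c (code_words e ws) <-> forall w, w \in ws -> r w i0 = i0).
Proof.
move=> rc i00.
have runE w : run n c (CodeSeq.code (codes (word w))) = r w i0 :> nat.
  by rewrite run_code -[in RHS](word_prodK w) (codes_action_word i0 _ rc) i00.
split=> [/allP fix0 w w_ws|fix0].
  have iws : (index w ws < size ws)%N by rewrite index_mem.
  have dropE := drop_codes (index w ws) ws.
  rewrite (drop_nth 1 iws) nth_index // in dropE.
  have := fix0 (index w ws); rewrite dropE code_eq0 log2_code_cons runE implyTb.
  rewrite mem_iota add0n leq0n andTb => rw; apply: val_inj; rewrite /= i00;
    apply/eqP/rw.
  apply: (leq_trans iws); rewrite -(size_map (fun w => codes (word w)) ws).
  rewrite -(size_map CodeSeq.code).
  exact: leq_trans (leq_addl _ _) (leq_size_code _).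
apply/allP => i _; apply/implyP; rewrite drop_codes.
case: (ltnP i (size ws)) => [iws _|/drop_oversize-> //].
by rewrite (drop_nth 1 iws) log2_code_cons runE fix0 ?mem_nth // i00.
Qed.

Lemma sum_size_code ws : (sumn [seq size (word w) | w <- ws] <= code_words e ws)%N.
Proof.
rewrite /code_words /code_seq2 -map_comp.
apply: leq_trans (leq_trans (leq_addr _ _) (leq_size_code _)).
elim: ws => //= w ws IHws; apply: leq_add => //.
have := leq_size_code (codes (word w)); rewrite size_map.
by apply: leq_trans; exact: leq_addl.
Qed.

End Coding.

Section Covered.
Variables (V : group_class) (A : choiceType) (L : seq A) (e : A -> nat).
Hypotheses (LA : forall a, a \in L) (e_inj : injective e).
Variable oracle : nat -> nat.
Local Notation W := (finite_trace V).
Hypothesis oracleP : forall t, (exists G, table_of t G) ->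
  (oracle (code_table t) = 1%N <-> exists2 G, table_of t G & W G).
Local Notation F := (free_group A).

Definition table_of_code k (k0 : (0 < k)%N) d :=
  Table (fun i j : 'I_k => Ordinal (ltn_digit d (i * k + j) k0)).

Lemma code_table_of_code k (k0 : (0 < k)%N) d :
  code_table (table_of_code k0 d) = table_code k d.
Proof.
rewrite /code_table /table_code /code_seq2 /= /mkseq; congr CodeSeq.code.
rewrite -map_comp -val_enum_ord -[RHS]map_comp; apply: eq_map => i /=.
by congr CodeSeq.code; rewrite -map_comp.
Qed.

Lemma group_of_code k (k0 : (0 < k)%N) d u : (u < k)%N -> group_code k d u ->
  exists G, table_of (table_of_code k0 d) G.
Proof.
move=> uk /allP grp; pose op := table_op (t := table_of_code k0 d).
pose u' := Ordinal uk.
have {}grp (i : 'I_k) : [/\ op u' i = i, op i u' = i,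
    exists j, op i j = u' /\ op j i = u' &
    forall j l, op (op i j) l = op i (op j l)].
  have /grp : (i : nat) \in iota 0 k by rewrite mem_iota ltn_ord.
  case/and4P => /eqP ui /eqP iu /hasP[j]; rewrite mem_iota => jk.
  move=> /andP[/eqP ij /eqP ji] /allP assoc; split; try exact: val_inj.
    by exists (Ordinal jk); split; apply: val_inj.
  move=> j' l; apply: val_inj.
  have /assoc/allP/(_ (l : nat)) : (j' : nat) \in iota 0 k.
    by rewrite mem_iota ltn_ord.
  by rewrite mem_iota ltn_ord => /(_ isT)/eqP.
have /boolp.choice[inv invP] : forall i, exists j, op i j = u' /\ op j i = u'.
  by move=> i; case: (grp i).
have opA : associative op by move=> i j l; case: (grp i).
have op1 : left_id u' op by move=> i; case: (grp i).
have op1r : right_id u' op by move=> i; case: (grp i).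
have opV : left_inverse u' inv op by move=> i; case: (invP i).
have opVr : right_inverse u' inv op by move=> i; case: (invP i).
pose G := HB.pack_for groupType 'I_k (isGroup.Build 'I_k opA op1 op1r opV opVr).
by exists G, (@id 'I_k); split=> //; exists id.
Qed.

(** A successful search gives a homomorphism [f] into a finite group of the
    variety through which the orbit of the state 0 factors, and a state outside
    of this orbit. *)
Lemma covered_group n c (r : {multiplicative F -> {perm 'I_n}}) (i0 : 'I_n) :
  codes_action e c r -> i0 = 0%N :> nat ->
  covered oracle (map e L) (letter_bound L e) n c ->
  exists (K : groupType) (f : {multiplicative F -> K}) (al : K -> 'I_n) (p : 'I_n),
    [/\ W K, forall x, al (f x) = r x i0 & forall z, al z <> p].
Proof.
move=> rc i00.
case/hasP => k _ /hasP[d _] /hasP[g _] /hasP[a _] /hasP[u uk] /hasP[p pn].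
rewrite mem_iota in uk; rewrite mem_iota in pn.
case/and5P => grp /eqP oracle1 /eqP au /allP comp /allP miss.
have k0 : (0 < k)%N by exact: leq_ltn_trans uk.
have n0 : (0 < n)%N by exact: leq_ltn_trans pn.
have gt := group_of_code k0 uk grp.
have [|G [ep [[ep' epK epK'] epM]] WG] := (oracleP gt).1.
  by rewrite code_table_of_code.
rewrite /= in ep ep' epK epK' epM.
pose op := table_op (t := table_of_code k0 d).
pose f : {multiplicative F -> G} :=
  free_ext (fun b => ep (Ordinal (ltn_digit g (e b) k0))).
pose al z := Ordinal (ltn_digit a (ep' z) n0).
have step b z : al (z * f (free_gen b)) = r (free_gen b) (al z).
  apply: val_inj;
    have /comp/allP/(_ (ep' z : nat)) : e b \in map e L by exact: map_f.
  rewrite mem_iota ltn_ord => /(_ isT)/eqP comp1.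
  have := rc (b, false) (al z); rewrite /code_letter addn0 letter_genE => rb.
  rewrite [RHS]rb /= -comp1 [f _](free_ext_gen _ b) -{1}[z]epK' -epM epK.
  by [].
have letter_step l z : al (z * f (letter_gen l)) = r (letter_gen l) (al z).
  case: l => b s; rewrite letter_genE; case: s => //.
  rewrite !homV; apply: esym; apply: (canLR (permK _)).
  by rewrite -step mulgVK.
exists G, f, al, (Ordinal pn); split=> // [x|z /(congr1 val) /= zp]; last first.
  have := miss (ep' z : nat); rewrite mem_iota ltn_ord => /(_ isT).
  by rewrite zp eqxx.
have -> : i0 = al 1.
  apply: val_inj; rewrite /= i00 -au; congr digit.
  have epu : ep (Ordinal uk) = 1.
    apply: (mulgI (ep (Ordinal uk))); rewrite mulg1 -epM; congr ep;
      apply: val_inj.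
    have /(allP grp)/and4P[/eqP uu _ _ _] // : u \in iota 0 k by rewrite mem_iota.
  by rewrite -epu epK.
rewrite -{1}[f x]mul1g -[x]word_prodK; elim: (word x) 1 => [|l w IHw] z.
  by rewrite /= !hom1 mulg1 perm1.
by rewrite /= !gmulfM mulgA IHw permM letter_step.
Qed.

(** Conversely, the data searched for are the multiplication table of [K], the
    images of the generators and the map [al], for an enumeration of [K]. *)
Lemma covered_of_group n c (r : {multiplicative F -> {perm 'I_n}}) (i0 : 'I_n)
    (K : groupType) (s : seq K) (f : {multiplicative F -> K}) (al : K -> 'I_n)
    (p : 'I_n) :
  codes_action e c r -> i0 = 0%N :> nat -> W K ->
  uniq s -> (forall z, z \in s) -> (size s <= n ^ n)%N ->
  al 1 = i0 -> (forall z a, al (z * f (free_gen a)) = r (free_gen a) (al z)) ->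
  (forall z, al z <> p) ->
  covered oracle (map e L) (letter_bound L e) n c.
Proof.
move=> rc i00 WK us sK sn al1 al_step miss; set k := size s.
pose el i := nth 1 s i; pose ix z := index z s.
have ixK z : el (ix z) = z by rewrite /el nth_index.
have ixk z : (ix z < k)%N by rewrite index_mem.
have elK i : (i < k)%N -> ix (el i) = i by move=> ik; rewrite /ix index_uniq.
have k0 : (0 < k)%N by exact: leq_ltn_trans (ixk 1).
have [m _|d dk dE] := @digit_code k (k * k) (fun m => ix (el (m %/ k) * el (m %% k))).
  exact: ixk.
have {}dE i j : (i < k)%N -> (j < k)%N -> digit k d (i * k + j) = ix (el i * el j).
  move=> ik jk; rewrite dE; last by nia.
  by rewrite divnMDl // modnMDl divn_small ?modn_small ?addn0.
have [m _|g gk gE] := @digit_code k (letter_bound L e) (fun m => ix (f (decode_letter L e m.*2))).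
  exact: ixk.
have {}gE a : digit k g (e a) = ix (f (free_gen a)).
  have := @code_letter_bound A L e LA (a, false);
    rewrite /code_letter addn0 => eb.
  rewrite gE; last by rewrite -ltn_double.
  have := @code_letterK A L e LA e_inj (a, false);
    rewrite /code_letter addn0 => ->.
  by rewrite letter_genE.
have [m _|a ak aE] := @digit_code n k (fun m => al (el m) : nat).
  exact: ltn_ord.
pose u := ix 1.
have elu : el u = 1 by exact: ixK.
have grp : group_code k d u.
  apply/allP => i; rewrite mem_iota => ik.
  rewrite !dE ?ixk // elu mul1g mulg1 elK // eqxx /=; apply/andP; split.
    apply/hasP; exists (ix (el i)^-1); first by rewrite mem_iota ixk.
    by rewrite !dE ?ixk // ixK mulgV mulVg eqxx.
  apply/allP => j; rewrite mem_iota => jk; apply/allP => l;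
    rewrite mem_iota => lk.
  by rewrite !dE ?ixk // !ixK mulgA.
apply/hasP; exists k; first by rewrite mem_iota.
apply/hasP; exists d; first by rewrite mem_iota.
apply/hasP; exists g; first by rewrite mem_iota.
apply/hasP; exists a; first by rewrite mem_iota.
apply/hasP; exists u; first by rewrite mem_iota ixk.
apply/hasP; exists (p : nat); first by rewrite mem_iota ltn_ord.
have tK : table_of (table_of_code k0 d) K.
  exists (fun i => el i); split=> /=.
    exists (fun z => Ordinal (ixk z)) => [i|z] /=; last exact: ixK.
    by apply: val_inj => /=; exact: elK.
  by move=> i j; rewrite dE ?ltn_ord // ixK.
apply/and5P; split=> //.
- rewrite -code_table_of_code; apply/eqP/oracleP; first by exists K.
  by exists K.
- by rewrite aE ?ixk // elu al1 i00.
- apply/allP => _ /mapP[b _ ->]; apply/allP => i; rewrite mem_iota => ik.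
  rewrite gE dE ?ixk // aE ?ixk // !ixK aE // al_step.
  have := rc (b, false) (al (el i));
    rewrite /code_letter addn0 letter_genE => ->.
  by [].
- apply/allP => i; rewrite mem_iota => ik; rewrite aE //.
  by apply/eqP => /val_inj; exact: miss.
Qed.

End Covered.

(** The test starts in the state 0, which has to be the base vertex. *)
Lemma connected_base_first (A : choiceType) (H : set (free_group A)) X :
  is_subgroup H -> connected H X ->
  exists Y, [/\ connected H Y, Y =i X, size Y = size X & index (coset_rep H 1) Y = 0%N].
Proof.
move=> HH [uX X1 XP]; pose Y := coset_rep H 1 :: rem (coset_rep H 1) X.
have XY : perm_eq X Y by exact: perm_to_rem.
exists Y; split; rewrite ?(perm_size XY) //=; last by rewrite eqxx.
- split; rewrite -?(perm_uniq XY) ?mem_head // => p.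
  rewrite -(perm_mem XY) => /XP[w Xw wp]; exists w => //.
  by apply: path_in_sub Xw => q; rewrite (perm_mem XY).
- by move=> q; rewrite (perm_mem XY).
Qed.

(** Finitely many separations can be made by one finite quotient. *)
Lemma separate_all (V : group_class) (HV : is_variety V) (G : groupType)
    (H : set G) (X : seq G) : pro_closure (finite_trace V) H `<=` H ->
  exists (K : groupType) (f : {multiplicative G -> K}), finite_trace V K /\
    forall p, p \in X -> (exists2 h, H h & f h = f p) -> H p.
Proof.
move=> clH; elim: X => [|p X [K1 [f1 [WK1 f1P]]]].
  have [K WK] := finite_trace_trivial HV.
  by exists K, (hom_of (fun x y : G => esym (mulg1 (1 : K)))).
have [Hp|nHp] := pselect (H p).
  by exists K1, f1; split=> // q; rewrite inE => /orP[/eqP->//|]; exact: f1P.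
have [K2 [f2 [WK2 f2P]]] : exists (K2 : groupType) (f2 : {multiplicative G -> K2}),
    finite_trace V K2 /\ ~ exists2 h, H h & f2 h = f2 p.
  apply: contrapT => no; apply: nHp; apply: clH;
    apply/(pro_closureP HV) => K f WK.
  by apply: contrapT => nof; apply: no; exists K, f.
have [K [f [WK fP]]] := finite_trace_pair HV f1 f2 WK1 WK2.
exists K, f; split=> // q;
  rewrite inE => /orP[/eqP-> [h Hh /fP[_ hp]]|qX [h Hh /fP[hq _]]].
  by case: f2P; exists h.
by apply: f1P => //; exists h.
Qed.

Section Decision.
Variables (V : group_class) (HV : is_variety V).
Variables (A : choiceType) (L : seq A) (e : A -> nat).
Hypotheses (LA : forall a, a \in L) (e_inj : injective e).
Hypothesis nontriv : exists2 w, normal_set (verbal V A) w & w <> 1.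
Variable oracle : nat -> nat.
Local Notation W := (finite_trace V).
Hypothesis oracleP : forall t, (exists G, table_of t G) ->
  (oracle (code_table t) = 1%N <-> exists2 G, table_of t G & W G).
Local Notation F := (free_group A).
Variable ws : seq F.
Let H := generated [set` ws].
Let HH : is_subgroup H. Proof. exact: generated_subgroup. Qed.
Local Notation x := (code_words e ws).
Local Notation n := (x.+2).

Let size_prefix : (size (prefix_reps H ws) < n)%N.
Proof.
rewrite ltnS; apply: leq_trans (size_prefix_reps H ws) _.
by rewrite ltnS; exact: sum_size_code.
Qed.

(** The Stallings graph is contained in a connected part of the coset graph that
    either has [n] vertices or is the whole graph. In the first case an action
    extending this part reaches all states from 0, and the test fails because no
    state is left for [p]; in the second case the group found by the test
    separates [H] from all other elements. *)
Lemma closedness_test_sound :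
  closedness_test oracle (map e L) (letter_bound L e) x -> pro_closed W H.
Proof.
move=> /allP test.
have [X cX [subX Xn Xfull]] := connected_grow HH (connected_prefix_reps H ws)
  (ltnW size_prefix).
have [Y [cY YX sY Y0]] := connected_base_first HH cX.
have [uY Y1 YP] := cY; rewrite -sY in Xn.
have [r rE] := partial_action HH uY (connected_rep HH cY) Xn.
have {}rE w : path_in H Y 1 w ->
    r (word_prod w) ord0 = index (coset_rep H (word_prod w)) Y :> nat.
  by move=> Yw; rewrite (rE w 1 ord0) ?Y0 // mul1g.
have {}rEx y : path_in H Y 1 (word y) -> r y ord0 = index (coset_rep H y) Y :> nat.
  by move=> /rE; rewrite word_prodK.
have [c [cn act rc]] := code_of_action LA e_inj r.
have /test : c \in iota 0 (n ^ ((letter_bound L e).*2 * n)).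
  by rewrite mem_iota.
rewrite act /=; have -> /= : fixes_code n c x.
  apply/(fixes_codeP ws rc (erefl : ord0 = 0%N :> nat)) => w w_ws.
  apply: val_inj; rewrite /= rEx.
    by rewrite (proj2 (coset_rep_mem HH w)) ?Y0 //; exact: sub_generated.
  apply: path_in_sub (path_in_prefix_reps H w_ws) => q /subX; rewrite YX.
  by [].
move=> /(covered_group LA oracleP rc (erefl : ord0 = 0%N :> nat)).
move=> [K [f [al [p [WK alE miss]]]]].
case: Xfull => [Xn'|full].
  have pY : (p < size Y)%N by rewrite sY Xn'.
  have [w Yw wp] := YP _ (mem_nth 1 pY).
  case: (miss (f (word_prod w))); apply: val_inj.
  by rewrite /= alE rE // wp index_uniq.
have Ypath y : path_in H Y 1 y by move=> i; rewrite YX.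
apply/pro_closedP => y /(pro_closureP HV)/(_ K f WK)[h Hh fhy].
have := rEx _ (Ypath (word h)); rewrite -alE fhy alE (rEx _ (Ypath _)).
rewrite (proj2 (coset_rep_mem HH h) Hh) Y0 => y0.
apply/(coset_rep_mem HH).
have yY : coset_rep H y \in Y by rewrite YX.
by rewrite -(nth_index 1 yY) y0 -Y0 nth_index.
Qed.

(** A closed subgroup contains the verbal subgroup, so the Stallings graph is the
    whole coset graph and has fewer than [n] vertices. Let [M] be the kernel of
    the action on the orbit of 0, and [f0] a homomorphism to a finite group of the
    variety that separates [H] from its other cosets. The kernel of [f0] is normal
    and contained in the stabilizer of 0, hence in [M]; so the quotient by [M] is
    a finite group of the variety, to be found by the search. *)
Lemma closedness_test_complete : pro_closed W H ->
  closedness_test oracle (map e L) (letter_bound L e) x.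
Proof.
move=> /pro_closedP clH; apply/allP => c _; apply/implyP => /andP[act fix0].
have [r rc] := action_of_code LA (ltn0Sn _) act.
have /(fixes_codeP ws rc (erefl : ord0 = 0%N :> nat)) {}fix0 := fix0.
have {fix0} rH h : H h -> r h ord0 = ord0.
  apply: (@generated_sub _ _ [set h | r h ord0 = ord0]) => //.
  split=> [|y z /= ry rz|y /= ry].
  - by rewrite /= hom1 perm1.
  - by rewrite gmulfM permM ry.
  - by rewrite homV; apply: (canLR (permK _)); rewrite ry.
have full g : coset_rep H g \in prefix_reps H ws.
  apply: full_prefix_reps nontriv _ g; [by case: (normalP (verbal V A)) | |].
    by left; exact: normalP.
  by move=> y Vy; apply: clH; exact: (verbal_sub_closure HV).
pose O : {set 'I_n} := [set i | `[< exists y, r y ord0 = i >]]%SET.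
have OP y : r y ord0 \in O by rewrite inE; apply/asboolP; exists y.
have OS g i : i \in O -> r g i \in O.
  by rewrite inE => /asboolP[y <-]; rewrite -permM -gmulfM OP.
have [p pO] : exists p, p \notin O.
  apply: contrapT => allO.
  have : (#|O| <= size (prefix_reps H ws))%N.
    rewrite -(size_map (fun q => r q ord0)); apply: leq_trans (card_size _).
    apply/subset_leq_card/fintype.subsetP => i; rewrite inE => /asboolP[y <-].
    apply/mapP; exists (coset_rep H y) => //.
    rewrite -{1}[y](mulgVK (coset_rep H y)) gmulfM permM rH //.
    exact: coset_repP.
  suff -> : #|O| = n by rewrite leqNgt size_prefix.
  rewrite -[RHS]card_ord; apply: eq_card => i; rewrite [RHS]inE.
  by apply: contrapT => /negP iO; apply: allO; exists i.
have [K0 [f0 [[VK0 _] f0P]]] := separate_all HV (prefix_reps H ws) clH.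
have kerH y : f0 y = 1 -> H y.
  move=> fy; have Hyq := coset_repP HH y.
  have Hq : H (coset_rep H y).
    apply: f0P => //; exists (y * (coset_rep H y)^-1)^-1.
      by case: HH => _ _; apply.
    by rewrite homV gmulfM fy mul1g homV invgK.
  by case: HH => _ HM _; have := HM _ _ Hyq Hq; rewrite mulgVK.
have MN : is_normal [set y | forall i, i \in O -> r y i = i].
  split; first split=> [i _|y z /= ry rz i iO|y /= ry i iO].
  - by rewrite hom1 perm1.
  - by rewrite gmulfM permM ry // rz.
  - by rewrite homV; apply: (canLR (permK _)); rewrite ry.
  move=> y g /= ry i iO; rewrite /conjg !gmulfM !permM ry ?OS //.
  by rewrite homV permKV.
pose M := NormalSubgroup MN; pose K := quotient_group M.
pose f : {multiplicative F -> K} := quotient_map M.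
have frep (z : K) : f (repr z) = z by exact: quotient_map_repr.
have fE y z : f y = f z -> forall i, i \in O -> r y i = r z i.
  move=> /quotient_mapP Myz i iO.
  by have := Myz (r y i) (OS y i iO); rewrite gmulfM permM homV permK.
have VK : V K.
  have [|g gE] := @factor_quotient _ _ (kernel f0) f.
    move=> y /= fy; apply/quotient_map_eq1 => i; rewrite inE => /asboolP[z <-].
    have Hc : H (z * y * z^-1) by apply: kerH;
      rewrite !gmulfM fy mulg1 -gmulfM mulgV hom1.
    by rewrite -permM -gmulfM -[z * y](mulgVK z) gmulfM permM (rH _ Hc).
  apply: (variety_image HV (f := g)); last exact: variety_of_kernel VK0.
  by move=> z; exists (quotient_map (kernel f0) (repr z)); rewrite gE.
pose th (z : K) : {ffun 'I_n -> 'I_n} := [ffun i => if i \in O then r (repr z) i else i].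
have thI : injective th.
  move=> z1 z2 /ffunP eq12; rewrite -(frep z1) -(frep z2).
  apply/quotient_mapP => i iO.
  have := eq12 (r (repr z1)^-1 i); rewrite !ffunE OS // => r12.
  by rewrite gmulfM permM -r12 -permM -gmulfM mulVg hom1 perm1.
have finK : finite_set [set: K].
  apply: (@sub_finite_set _ _ (th @^-1` setT)) => //.
  by apply: finite_preimage;
    [move=> ? ? _ _; exact: thI | exact: finite_finset].
have [s sK] := (finite_seqP _).1 finK.
apply: (covered_of_group LA e_inj oracleP (s := undup s) (f := f)
  (al := fun z => r (repr z) ord0) (p := p) rc (erefl : ord0 = 0%N :> nat)) => //.
- exact: undup_uniq.
- by move=> z; rewrite mem_undup; have : [set` s] z by rewrite -sK.
- rewrite -(size_map th); have /card_uniqP <- : uniq (map th (undup s)).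
    by rewrite map_inj_uniq ?undup_uniq.
  by rewrite (leq_trans (max_card _)) // card_ffun !card_ord.
- have /fE/(_ ord0) -> : f (repr (1 : K)) = f 1 by rewrite frep hom1.
    by rewrite hom1 perm1.
  by have := OP 1; rewrite hom1 perm1.
- move=> z a; rewrite -permM -gmulfM; apply: fE;
  first by rewrite frep gmulfM frep.
  by have := OP 1; rewrite hom1 perm1.
- by move=> z zp; move: pO; rewrite -zp OP.
Qed.

End Decision.

Lemma constant_decidable (T : Type) (D : set T) (code : T -> nat) (P : T -> Prop)
    (b : bool) : (forall t, D t -> (P t <-> b)) -> recursively_decidable D code P.
Proof.
move=> DP; exists (fun=> nat_of_bool b); split.
  exact: (recursive_const 1 b).
by move=> t /DP ->; case: (b).
Qed.

Theorem theorem3p1 (V : group_class) (HV : is_variety V) (A : choiceType) :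
  (forall H : set (free_group A), is_subgroup H -> finitely_generated H ->
    let Cl := pro_closure (finite_trace V) H in
    let pi := quotient_map (verbal V A) in
    [/\ Cl = pi @^-1` pro_closure finite_groups (pi @` H) /\
        set_prod H (normal_set (verbal V A)) `<=` Cl,
        infinite_set [set: A] ->
          (finitely_generated Cl <-> forall G, V G) &
        finite_set [set: A] ->
        ~ ((exists a : A, [set: A] = [set a]) /\ H = [set 1]) ->
          (finitely_generated Cl <-> (forall G, V G) \/ finite_index Cl)])
  /\
  (decidable_class (finite_trace V) ->
   decidable_closedness (finite_trace V) A).
Proof.
split=> [H HH [ws ->] Cl pi|[f [rec_f fP]] B e Be].
  have HCl : is_subgroup Cl by exact/pro_closure_subgroup/generated_subgroup.
  split.
  - split; first exact: pro_closure_relatively_free.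
    exact: verbal_sub_pro_closure.
  - move=> infA; split; first exact: closure_infinite_rank.
    exact: closure_finitely_generated_all.
  - move=> finA nexc; split; first exact: closure_finite_rank.
    case=> [Vall|]; first exact: closure_finitely_generated_all.
    exact: finite_index_finitely_generated.
have [triv|ntriv] := pselect (normal_set (verbal V A) `<=` [set 1]).
  apply: (@constant_decidable _ _ _ _ true) => ws _; split=> // _.
  by apply/pro_closedP; exact: verbal_trivial_closed triv.
have nontriv : exists2 w, normal_set (verbal V A) w & w <> 1.
  apply: contrapT => no; apply: ntriv => w Vw; apply: contrapT => w1.
  by apply: no; exists w.
have closed_letters (ws : seq (free_group A)) (C : set A) : words_over C ws ->
    pro_closed (finite_trace V) (generated [set` ws]) -> forall a, C a.
  move=> wsC /pro_closedP clH.
  apply: (normal_all_letters (normalP (verbal V A)) nontriv _ wsC).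
  by move=> y Vy; apply: clH; exact: (verbal_sub_closure HV).
have [BT|/existsNP[a nBa]] := pselect (forall a, B a); last first.
  apply: (@constant_decidable _ _ _ _ false) => ws wsB; split=> // cl.
  by case: nBa; exact: closed_letters wsB cl a.
have [[L AL]|infA] := pselect (exists L : seq A, forall a, a \in L); last first.
  apply: (@constant_decidable _ _ _ _ false) => ws wsB; split=> // cl.
  case: infA; exists (flatten [seq map fst (word g) | g <- ws]) => a.
  apply: (closed_letters ws [set` flatten [seq map fst (word g) | g <- ws]]) => //.
  move=> g g_ws l lg /=; apply/flattenP; exists (map fst (word g));
    last exact: map_f.
  exact: (map_f (fun g : free_group A => map fst (word g))).
have e_inj : injective e by move=> a b; apply: Be; apply/mem_set; exact: BT.
pose oracle m := f [tuple m].
have rec_oracle : recursive 1 (fun s => oracle (nth 0%N s 0%N)).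
  rewrite /recursive; move: rec_f; congr total_recursive; apply/funext => s.
  by congr f; apply: val_inj => /=; case: s => -[|m [|]].
exists (fun s => closedness_test oracle (map e L) (letter_bound L e) (nth 0%N s 0%N)).
split; first exact: recursive_closedness_test rec_oracle.
move=> ws _ /=; split=> [test|cl].
  apply: (closedness_test_sound HV AL e_inj (oracle := oracle) fP).
  by move: test; case: (closedness_test _ _ _ _).
by rewrite (closedness_test_complete HV AL e_inj nontriv (oracle := oracle) fP cl).
Qed.
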